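(* Let $\mathcal T=\{\tau_1,\tau_2\}$ where $\tau_1,\tau_2$ are rectangles in $\mathbb R^2$ whose corresponding dimensions are irrationally related (the ratio of the width of $\tau_1$ to the width of $\tau_2$ is irrational, and the ratio of the height of $\tau_1$ to the height of $\tau_2$ is irrational). Then the translation action $(Y_{\mathcal T},\{S_{\vec v}\}_{\vec v\in\mathbb R^2})$ has zero topological entropy.
   Context: Rectangles have sides parallel to the coordinate axes. A $\mathcal T$-tiling of $\mathbb R^2$ is a covering of $\mathbb R^2$ by translates of tiles from $\mathcal T$ that overlap only on boundaries of the tiles. $Y_{\mathcal T}$ is the set of all $\mathcal T$-tilings, and $S_{\vec v}y$ is the tiling $y$ translated by $-\vec v$. $Y_{\mathcal T}$ carries its compact metrizable topology of local convergence: $y_n\to y$ if and only if, for each tile type, the sets of lower left corners of tiles of that type in $y_n$ converge locally (in the Fell / vague sense for uniformly discrete sets) to the corresponding set for $y$. The topological entropy of the $\mathbb R^2$-action is the topological entropy of the $\mathbb Z^2$-subaction $(S_{\vec v})_{\vec v\in\mathbb Z^2}$. *)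

(* Defs.v *)
From HB Require Import structures.
From mathcomp Require Import all_boot all_order all_algebra.
From mathcomp Require Import all_classical all_reals all_analysis.
Set Implicit Arguments.
Unset Strict Implicit.
Unset Printing Implicit Defensive.
Import Order.TTheory GRing.Theory Num.Theory numFieldNormedType.Exports.

Local Open Scope classical_set_scope.
Local Open Scope card_scope.
Local Open Scope ring_scope.

(** Topological entropy by open covers (Adler, Konheim and McAndrew). *)
Section Entropy.
Context {R : realType} {X : topologicalType}.

Definition covering (U : set (set X)) : Prop := \bigcup_(A in U) A = setT.

Definition open_covering (U : set (set X)) : Prop := U `<=` open /\ covering U.

(* The value is +oo when [U] has no finite subcover. *)
Definition cover_number (U : set (set X)) : \bar R :=
  ereal_inf [set n%:R%:E | n in
    [set n : nat | exists2 V, V `<=` U & V #= `I_n /\ covering V]].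

(* The join of the covers [S_v^-1 U] for [v] in the square [0, n)^2: its
   members are the intersections of the sets [S_v^-1 A_v] over all choices of
   the members [A_v] of [U]. *)
Definition iterated_join (S : int * int -> X -> X) (U : set (set X)) (n : nat) :
    set (set X) :=
  [set \bigcap_(v : 'I_n * 'I_n) (S (v.1%:Z, v.2%:Z) @^-1` A v)
    | A in [set A : 'I_n * 'I_n -> set X | forall v, U (A v)]].

(* For a continuous action on a compact space the sequence converges, by
   subadditivity, so the upper limit is the usual limit. *)
Definition cover_entropy (S : int * int -> X -> X) (U : set (set X)) : \bar R :=
  limn_esup (fun n : nat =>
    (((n ^ 2)%N%:R)^-1%:E * lne (cover_number (iterated_join S U n)))%E).

Definition entropyZ2 (S : int * int -> X -> X) : \bar R :=
  ereal_sup [set cover_entropy S U | U in open_covering].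

Definition entropyR2 (S : R * R -> X -> X) : \bar R :=
  entropyZ2 (fun v => S (v.1%:~R, v.2%:~R)).

End Entropy.

Section Tilings.
Context {R : realType} {k : nat}.
Variables w h : 'I_k -> R.

Definition frontier (A : set (R * R)) : set (R * R) := closure A `\` interior A.

(* The translate of the [i]-th rectangle with lower left corner [p]. *)
Definition tile (i : 'I_k) (p : R * R) : set (R * R) :=
  `[p.1, p.1 + w i] `*` `[p.2, p.2 + h i].

(* A tiling is encoded by the set [C i] of the lower left corners of its tiles
   of each type [i]. *)
Definition is_tiling (C : 'I_k -> set (R * R)) : Prop :=
  (forall x, exists i p, C i p /\ tile i p x) /\
  (forall i j p q, C i p -> C j q -> (i, p) <> (j, q) ->
    tile i p `&` tile j q `<=` frontier (tile i p) `&` frontier (tile j q)).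

Record tiling := Tiling {
  corners :> 'I_k -> set (R * R);
  cornersP : is_tiling corners
}.

HB.instance Definition _ := gen_eqMixin tiling.
HB.instance Definition _ := gen_choiceMixin tiling.

(* Subbase of the Fell topology on each of the sets of lower left corners: the
   sets of tilings whose type [i] corners miss a given compact set, or meet a
   given open set. *)
Definition fell_subbase : set (set tiling) :=
  [set B | exists i K, compact K /\ B = [set y : tiling | y i `&` K = set0]] `|`
  [set B | exists i G, open G /\ B = [set y : tiling | y i `&` G !=set0]].

HB.instance Definition _ := isSubBaseTopological.Build tiling fell_subbase id.

Lemma tile_shift i (v p x : R * R) : tile i (p + v) (x + v) <-> tile i p x.
Proof. by rewrite /tile /= !in_itv /= !(addrAC _ v.1) !(addrAC _ v.2) !lerD2r. Qed.

Lemma interior_shift (A : set (R * R)) (v : R * R) :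
  interior ((fun x => x + v) @^-1` A) = (fun x => x + v) @^-1` interior A.
Proof.
have cs (B : set (R * R)) (u x : R * R) : nbhs (x + u) B -> nbhs x ((fun y => y + u) @^-1` B).
  apply: (@continuousD _ _ _ id (cst u) x); [exact: cvg_id|exact: cvg_cst].
apply/seteqP; split=> x /= => [Ax|]; last exact: cs.
have := cs ((fun y => y + v) @^-1` A) (- v) (x + v); rewrite addrK => /(_ Ax).
by rewrite /interior; apply: filterS => y /=; rewrite subrK.
Qed.

Lemma frontier_shift (A : set (R * R)) (v : R * R) :
  frontier ((fun x => x + v) @^-1` A) = (fun x => x + v) @^-1` frontier A.
Proof.
have closE (B : set (R * R)) : closure B = ~` interior (~` B).
  by rewrite interiorC setCK.
by rewrite /frontier !closE preimage_setC !interior_shift.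
Qed.

Lemma translate_subproof (v : R * R) (y : tiling) :
  is_tiling (fun i => (fun p => p + v) @^-1` y i).
Proof.
case: y => C [Ccov Cdisj] /=; split=> [x|i j p q Cp Cq ne].
  have [i [p [Cp px]]] := Ccov (x + v); exists i, (p - v); split => /=.
    by rewrite subrK.
  by apply/(tile_shift i v); rewrite subrK.
have tileE a r : tile a r = (fun x => x + v) @^-1` tile a (r + v).
  by apply/seteqP; split=> x /=; rewrite tile_shift.
rewrite (tileE i p) (tileE j q) !frontier_shift => x; apply: Cdisj => //.
case=> ij /addIr p1 /addIr p2; apply: ne.
by rewrite ij (surjective_pairing p) p1 p2 -surjective_pairing.
Qed.

(* The tiling [y] translated by [- v]. *)
Definition translate (v : R * R) (y : tiling) : tiling :=
  Tiling (translate_subproof v y).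

End Tilings.

(* Main.v *)
Require Import Defs.
From mathcomp Require Import all_boot all_order all_algebra.
From mathcomp Require Import all_classical all_reals all_analysis.
From mathcomp Require Import finmap lra zify ring.
Set Implicit Arguments.
Unset Strict Implicit.
Unset Printing Implicit Defensive.
Import Order.TTheory GRing.Theory Num.Theory numFieldNormedType.Exports.
Local Open Scope ring_scope.

(** A row of tiles standing on a horizontal line is a word in the two types, and
by irrationality two rows of equal length are permutations of each other. If a
word contains a run of one type enclosed by the other type, the two vertical
sides of that run can never end, since the tiles on their two sides would have
to match in number; so the run repeats itself upwards forever. These rays, and
their analogues in the three other directions, reach the boundary of an [n] by
[n] window, so there are only [O(n)] of them. Every other row has at most two
runs, and the row hanging below it is its reversal, unless the two words agree;
in that case a vertical line separates the types at a crossing of four tiles,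
which forces a ray or a pure column that reaches the boundary, so this happens
[O(n)] times as well. Read from the bottom upwards, the tiling of the window is
thus determined by the tiles along its frame and by [O(n)] marks. The real
coordinates enter only through the signs of polynomially many affine functions
of the [O(n)] coordinates of the frame, so there are [exp(O(n log n))] tilings of
the window up to a small error, and the entropy vanishes. *)

(** * Dissections of the plane into two kinds of rectangles *)

(** A tiling has continuous parameters, so a finite code can fix it only approximately. For a given
    open cover a Lebesgue number supplies a tolerance [e], and the code need only fix corners up to
    [e]: besides the mutual order of the coordinates it records their order against the multiples of
    [e]. Signs suffice because the reconstruction handles coordinates only by comparing them and by
    adding side lengths.

    Marks are counted through one real key each: within a kind, keys of distinct marks are at least
    [m] apart, where [m] bounds the sides from below. A mark stores the first letter of its row, the
    letter after the change and some positions. This is enough, since two irregular rows with a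
    common start first disagree where exactly one of them changes type, and every change of an
    irregular row carries a mark. Irregularity itself is visible from the marks.

    Arguments are made in one orientation and transported: [dissection] is stable under reflections
    and under transposition, which exchanges [W] and [H]. This is why sides and corners are bare
    parameters here. *)

Section Dissection.
Context {R : realType}.
Implicit Types (W H : bool -> R) (T : bool -> R -> R -> Prop).

(* [T b p q] means that a tile of type [b] has its lower left corner at [(p, q)]. *)
Definition dissection W H T : Prop :=
  (forall x y, exists b p q,
     [/\ T b p q, p <= x, x <= p + W b, q <= y & y <= q + H b]) /\
  (forall b p q b' p' q', T b p q -> T b' p' q' ->
     p < p' + W b' -> p' < p + W b -> q < q' + H b' -> q' < q + H b ->
     [/\ b = b', p = p' & q = q']).

(** The lower left corner of a reflected tile is the image of the old lower right corner, hence the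
    shift by [W b]. *)
Definition flipx W T b p q : Prop := T b (- p - W b) q.
Definition flipy H T b p q : Prop := T b p (- q - H b).
Definition transp T b p q : Prop := T b q p.

Lemma flipx_dissection W H T : dissection W H T -> dissection W H (flipx W T).
Proof.
move=> [cov dis]; split=> [x y|b p q b' p' q' t t' h1 h2 h3 h4].
  have [b [p [q [t h1 h2 h3 h4]]]] := cov (- x) y.
  exists b, (- p - W b), q; split=> //; try lra.
  by rewrite /flipx opprB opprK addrAC subrr add0r.
have [] := dis _ _ _ _ _ _ t t'; try lra.
by move=> -> e ->; split=> //; lra.
Qed.

Lemma flipy_dissection W H T : dissection W H T -> dissection W H (flipy H T).
Proof.
move=> [cov dis]; split=> [x y|b p q b' p' q' t t' h1 h2 h3 h4].
  have [b [p [q [t h1 h2 h3 h4]]]] := cov x (- y).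
  exists b, p, (- q - H b); split=> //; try lra.
  by rewrite /flipy opprB opprK addrAC subrr add0r.
have [] := dis _ _ _ _ _ _ t t'; try lra.
by move=> -> -> e; split=> //; lra.
Qed.

Lemma transp_dissection W H T : dissection W H T -> dissection H W (transp T).
Proof.
move=> [cov dis]; split=> [x y|b p q b' p' q' t t' h1 h2 h3 h4].
  have [b [p [q [t h1 h2 h3 h4]]]] := cov y x.
  by exists b, q, p; split.
by have [-> -> ->] := dis _ _ _ _ _ _ t t' h3 h4 h1 h2.
Qed.

Lemma truncn_close (m x x' : R) : 0 < m -> 0 <= x -> 0 <= x' ->
  Num.truncn (x / m) = Num.truncn (x' / m) -> `|x - x'| < m.
Proof.
move=> m0 x0 x0' e.
have /andP[] := @truncn_itv _ (x / m) (divr_ge0 x0 (ltW m0)).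
have /andP[] := @truncn_itv _ (x' / m) (divr_ge0 x0' (ltW m0)).
rewrite e !ler_pdivlMr// !ltr_pdivrMr// -natr1 mulrDl mul1r.
by move=> *; rewrite ltr_norml; apply/andP; split; lra.
Qed.

Section Local.
Variables (W H : bool -> R) (T : bool -> R -> R -> Prop) (m : R).
Hypotheses (m0 : 0 < m) (mW : forall b, m <= W b) (mH : forall b, m <= H b).
Hypothesis dT : dissection W H T.

Lemma dissection_inj b p q b' p' q' : T b p q -> T b' p' q' ->
  p < p' + W b' -> p' < p + W b -> q < q' + H b' -> q' < q + H b ->
  [/\ b = b', p = p' & q = q'].
Proof. exact: dT.2. Qed.

Lemma corner_type b b' p q : T b p q -> T b' p q -> b = b'.
Proof.
move=> t t'; have [] := dissection_inj t t' => //.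
all: by rewrite ltrDl (lt_le_trans m0).
Qed.

(** Two tiles of one type with corners in the same square cell of side [m] overlap, hence coincide,
    and finitely many cells cover the box. *)
Lemma local_finite (M : R) : exists l : seq (bool * R * R),
  forall b p q, T b p q -> `|p| <= M -> `|q| <= M -> (b, p, q) \in l.
Proof.
pose K := (Num.truncn ((M + M) / m)).+1.
pose cell (b : bool) (i j : 'I_K) (z : bool * R * R) :=
  [/\ T z.1.1 z.1.2 z.2, `|z.1.2| <= M & `|z.2| <= M] /\
  [/\ z.1.1 = b, Num.truncn ((z.1.2 + M) / m) = i
    & Num.truncn ((z.2 + M) / m) = j].
have cell1 (c : bool * 'I_K * 'I_K) :
    exists z0, forall z, cell c.1.1 c.1.2 c.2 z -> z = z0.
  case: c => [[b i] j] /=.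
  have [[z0 [[t0 p0 q0] [b0 i0 j0]]]|nz] := EM (exists z, cell b i j z); last first.
    by exists (b, 0, 0) => z cz; case: nz; exists z.
  exists z0 => z [[t p q] [bz iz jz]].
  case: z z0 t p q bz iz jz t0 p0 q0 b0 i0 j0 => [[b1 p1] q1] [[b2 p2] q2] /=.
  rewrite !ler_norml => t /andP[? ?] /andP[? ?] bz iz jz.
  move=> t0 /andP[? ?] /andP[? ?] b0 i0 j0.
  have /truncn_close : Num.truncn ((p1 + M) / m) = Num.truncn ((p2 + M) / m).
    by rewrite iz i0.
  have /truncn_close : Num.truncn ((q1 + M) / m) = Num.truncn ((q2 + M) / m).
    by rewrite jz j0.
  rewrite !ltr_norml => /(_ m0) h1 /(_ m0) h2.
  have /andP[? ?] : - m < q1 + M - (q2 + M) < m by apply: h1; lra.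
  have /andP[? ?] : - m < p1 + M - (p2 + M) < m by apply: h2; lra.
  have := mW b1; have := mW b2; have := mH b1; have := mH b2 => *.
  by have [||||-> -> ->//] := dissection_inj t t0; lra.
have [f fP] := choice cell1.
exists [seq f c | c <- enum {: bool * 'I_K * 'I_K}] => b p q t pM qM.
have lt z : `|z| <= M -> (Num.truncn ((z + M) / m) < K)%N.
  rewrite ler_norml => /andP[? ?]; rewrite ltnS; apply: le_truncn.
  by rewrite ler_pM2r ?invr_gt0//; lra.
apply/mapP; exists (b, Ordinal (lt _ pM), Ordinal (lt _ qM)).
  by rewrite mem_enum.
by apply: (fP (b, Ordinal (lt _ pM), Ordinal (lt _ qM))); split.
Qed.

(** The closed tiles cover [(x + d, y + d)] for every small [d > 0], and only finitely many tiles
    are near. If none contained [(x, y)] in the half-open sense, all of them would miss these points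
    for small [d]. The half-open form singles out the tile to the north-east of a point. *)
Lemma cover_ne x y : exists b p q,
  [/\ T b p q, p <= x, x < p + W b, q <= y & y < q + H b].
Proof.
apply: contrapT => nc.
(* Any tile containing [(x + d, y + d)] with [d < m] has its corner in the box of half-width [M]. *)
pose M := `|x| + `|y| + m + \sum_b (W b + H b).
have WH b : W b + H b <= \sum_b (W b + H b).
  have W0 c : 0 <= W c by rewrite (le_trans (ltW m0)).
  have H0 c : 0 <= H c by rewrite (le_trans (ltW m0)).
  have := W0 (~~ b); have := H0 (~~ b).
  by rewrite big_bool; case: b => /= *; lra.
have [l lP] := local_finite M.
have small (s : seq (bool * R * R)) : exists2 e, 0 < e & forall d, 0 < d -> d < e ->
    forall z, z \in s -> T z.1.1 z.1.2 z.2 ->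
    ~ [/\ z.1.2 <= x + d, x + d <= z.1.2 + W z.1.1, z.2 <= y + d
        & y + d <= z.2 + H z.1.1].
  elim: s => [|[[b p] q] s [e e0 IH]]; first by exists 1.
  have [t|nt] := EM (T b p q); last first.
    by exists e => // d d0 de z; rewrite inE => /predU1P[->//|]; exact: IH.
  suff [e' e0' he'] : exists2 e', 0 < e' & forall d, 0 < d -> d < e' ->
      ~ [/\ p <= x + d, x + d <= p + W b, q <= y + d & y + d <= q + H b].
    exists (Num.min e e'); first by rewrite lt_min e0.
    move=> d d0; rewrite lt_min => /andP[de de'] z; rewrite inE => /predU1P[->|].
      by move=> _; exact: he'.
    exact: IH.
  case: (ltrP x p) => xp; first by exists (p - x); [lra|move=> d ? ? []; lra].
  case: (ltrP y q) => yq; first by exists (q - y); [lra|move=> d ? ? []; lra].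
  exists 1 => // d d0 _ [h1 h2 h3 h4]; apply: nc; exists b, p, q; split=> //; lra.
have [e e0 eP] := small l.
pose d := Num.min e m / 2.
have d0 : 0 < d by rewrite /d divr_gt0// lt_min e0.
have [de dm] : d < e /\ d < m.
  have : Num.min e m <= e by rewrite ge_min lexx.
  have : Num.min e m <= m by rewrite ge_min lexx orbT.
  rewrite /d in d0 *; split; lra.
have [b [p [q [t h1 h2 h3 h4]]]] := dT.1 (x + d) (y + d).
apply: (eP d d0 de (b, p, q)) => //; apply: lP => //.
all: have := WH b; have := mW b; have := mH b; move: (ler_norm x) (ler_norm y).
all: have := ler_norm (- x); have := ler_norm (- y); rewrite !normrN => *.
all: by rewrite ler_norml /M; apply/andP; split; lra.
Qed.
End Local.
End Dissection.

(** * Rows of tiles along a line, and the rays forced by independence of the lengths *)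

Section Rows.
Context {R : realType}.
Implicit Types (W H : bool -> R) (T : bool -> R -> R -> Prop) (s : seq bool).

Definition extent W s : R := \sum_(b <- s) W b.

Lemma extent_nil W : extent W [::] = 0. Proof. by rewrite /extent big_nil. Qed.

Lemma extent_cons W b s : extent W (b :: s) = W b + extent W s.
Proof. by rewrite /extent big_cons. Qed.

Lemma extent_cat W s1 s2 : extent W (s1 ++ s2) = extent W s1 + extent W s2.
Proof. by rewrite /extent big_cat. Qed.

Lemma extent_rcons W s b : extent W (rcons s b) = extent W s + W b.
Proof. by rewrite -cats1 extent_cat extent_cons extent_nil addr0. Qed.

Lemma extent_nseq W k b : extent W (nseq k b) = k%:R * W b.
Proof. by rewrite /extent big_nseq -Monoid.iteropE /= mulr_natl. Qed.

(** This is the only form in which irrationality is used. *)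
Definition indep W := forall s t, extent W s = extent W t -> perm_eq s t.

Record irr_dissection (m : R) W H T : Prop := IrrDissection {
  mesh_gt0 : 0 < m;
  mesh_leW : forall b, m <= W b;
  mesh_leH : forall b, m <= H b;
  indepW : indep W;
  indepH : indep H;
  irr_diss : dissection W H T }.

Lemma flipx_irr m W H T : irr_dissection m W H T -> irr_dissection m W H (flipx W T).
Proof. by case=> *; split=> //; exact: flipx_dissection. Qed.

Lemma flipy_irr m W H T : irr_dissection m W H T -> irr_dissection m W H (flipy H T).
Proof. by case=> *; split=> //; exact: flipy_dissection. Qed.

Lemma transp_irr m W H T : irr_dissection m W H T -> irr_dissection m H W (transp T).
Proof. by case=> *; split=> //; exact: transp_dissection. Qed.

Fixpoint tile_row W T v x s : Prop :=
  if s is b :: s' then T b x v /\ tile_row W T v (x + W b) s' else True.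

(** After reflection in the horizontal axis, tiles hanging below height [v] stand on height [- v],
    so facts on standing rows apply to both. *)
Definition hung_row W H T v x s := tile_row W (flipy H T) (- v) x s.

Definition hwall W H T y x1 x2 := forall b p q, T b p q ->
  q < y -> y < q + H b -> p < x2 -> x1 < p + W b -> False.

Lemma tile_row_cat W T v x s1 s2 :
  tile_row W T v x (s1 ++ s2) <-> tile_row W T v x s1 /\ tile_row W T v (x + extent W s1) s2.
Proof.
elim: s1 x => [|b s1 IH] x /=; first by rewrite extent_nil addr0; tauto.
by rewrite IH extent_cons addrA; tauto.
Qed.

Lemma tile_row_rcons W T v x s b :
  tile_row W T v x (rcons s b) <-> tile_row W T v x s /\ T b (x + extent W s) v.
Proof. by rewrite -cats1 tile_row_cat /=; tauto. Qed.

Lemma hung_row_cons W H T v x b s :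
  hung_row W H T v x (b :: s) <-> T b x (v - H b) /\ hung_row W H T v (x + W b) s.
Proof. by rewrite /hung_row /= /flipy opprK. Qed.

Lemma hung_row_cat W H T v x s1 s2 :
  hung_row W H T v x (s1 ++ s2) <-> hung_row W H T v x s1 /\ hung_row W H T v (x + extent W s1) s2.
Proof. exact: tile_row_cat. Qed.

Section Walk.
Variables (m : R) (W H : bool -> R) (T : bool -> R -> R -> Prop).
Hypothesis G : irr_dissection m W H T.
Let m0 := mesh_gt0 G.
Let mW := mesh_leW G.
Let mH := mesh_leH G.
Let dT := irr_diss G.

Lemma width_gt0 b : 0 < W b. Proof. exact: lt_le_trans m0 (mW b). Qed.

Lemma height_gt0 b : 0 < H b. Proof. exact: lt_le_trans m0 (mH b). Qed.

Lemma extent_ge0 s : 0 <= extent W s.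
Proof. by apply: sumr_ge0 => b _; exact: ltW (width_gt0 b). Qed.

Lemma extent_gt0 s : s != [::] -> 0 < extent W s.
Proof.
by case: s => // b s _; rewrite extent_cons ltr_wpDr ?extent_ge0// width_gt0.
Qed.

(** The tile to the north-east of [(x, v)] cannot start below [v], as nothing crosses the line
    there, nor to the left of [x], where it would overlap the tile [b0]. *)
Lemma tile_row_step b0 p0 q0 x v : T b0 p0 q0 -> p0 + W b0 = x -> q0 <= v ->
  v < q0 + H b0 ->
  (forall b p q, T b p q -> q < v -> v < q + H b -> p <= x -> x < p + W b -> False) ->
  exists b, T b x v.
Proof.
move=> t0 e0 q0v vq0 nb.
have [b [p [q [t px xp qv vq]]]] := cover_ne m0 mW mH dT x v.
have qE : q = v.
  by apply/eqP; rewrite eq_le qv /= leNgt; apply/negP => /(nb _ _ _ t)/(_ vq px xp).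
have pE : p = x.
  apply/eqP; rewrite eq_le px /= leNgt; apply/negP => px'.
  have W0 := width_gt0 b0; have Hb := height_gt0 b.
  by have [||||bE e _] := dissection_inj dT t0 t; subst; lra.
by exists b; rewrite -pE -qE.
Qed.

Lemma tile_row_walk b x v x2 : T b x v -> hwall W H T v x x2 -> x < x2 ->
  exists s, [/\ tile_row W T v x (b :: s), x2 <= x + extent W (b :: s)
    & x + extent W (b :: s) - W (last b s) < x2].
Proof.
(* Every tile of the walk is at least [m] wide, so [n] bounds their number. *)
have [n] : exists n : nat, x2 - x < n%:R * m.
  exists (Num.truncn ((x2 - x) / m)).+1.
  by rewrite -ltr_pdivrMr//; exact: truncnS_gt.
elim: n b x => [|n IH] b x; first by rewrite mul0r => *; lra.
rewrite -natr1 => le t wall xx2.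
have [xle|xlt] := leP x2 (x + W b).
  by exists [::]; rewrite extent_cons extent_nil /=; split=> //; lra.
have := mW b; have := m0 => *.
have [b' t'] : exists b', T b' (x + W b) v.
  apply: (tile_row_step t) => //; first by rewrite ltrDl height_gt0.
  by move=> b1 p q t1 q1 q2 p1 p2; apply: (wall _ _ _ t1) => //; lra.
have [||s [r1 r2 r3]] := IH _ _ _ t' _ xlt; first by lra.
  by move=> b1 p q t1 q1 q2 p1 p2; apply: (wall _ _ _ t1) => //; lra.
by exists (b' :: s); rewrite extent_cons /=; split=> //; move: r2 r3; lra.
Qed.

Lemma tile_row_last b s x v : tile_row W T v x (b :: s) ->
  T (last b s) (x + extent W (b :: s) - W (last b s)) v.
Proof.
case/lastP: s => [|s c]; first by rewrite /= extent_cons extent_nil addr0 addrK; case.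
rewrite -rcons_cons tile_row_rcons last_rcons extent_rcons.
by rewrite addrA addrK => -[].
Qed.

(** The last tile of the walk cannot overshoot [x2], since it would overlap the tile [b2] that
    starts there. *)
Lemma tile_row_block b x v x2 b2 q2 : T b x v -> hwall W H T v x x2 -> x < x2 ->
  T b2 x2 q2 -> q2 <= v -> v < q2 + H b2 ->
  exists s, tile_row W T v x (b :: s) /\ x + extent W (b :: s) = x2.
Proof.
move=> t wall xx2 t2 h1 h2.
have [s [r1 r2 r3]] := tile_row_walk t wall xx2.
exists s; split=> //; apply/eqP; rewrite eq_le r2 andbT leNgt; apply/negP => lt.
have tl := tile_row_last r1; have := width_gt0 b2; have := height_gt0 (last b s) => *.
by have [||||_ e _] := dissection_inj dT tl t2; lra.
Qed.

Lemma tile_row_hwall v x b s : tile_row W T v x (b :: s) -> hwall W H T v x (x + extent W (b :: s)).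
Proof.
elim: s x b => [|c s IH] x b r.
  move: r; rewrite extent_cons extent_nil addr0 => -[t _] b' p q t' q1 q2 p1 p2.
  have Hb := height_gt0 b.
  by have [||||_ _ e] := dissection_inj dT t t'; lra.
case: r => t r b' p q t' q1 q2 p1 p2; have Hb := height_gt0 b.
have [lt|le] := ltP p (x + W b).
  by have [||||_ _ e] := dissection_inj dT t t'; lra.
apply: (IH _ _ r _ _ _ t') => //; first by rewrite -addrA -extent_cons.
by rewrite (le_lt_trans le)// ltrDl width_gt0.
Qed.

Lemma hwall_flipy y x1 x2 : hwall W H (flipy H T) (- y) x1 x2 -> hwall W H T y x1 x2.
Proof.
move=> wall b p q t q1 q2 p1 p2; apply: (wall b p (- q - H b)) => //; last 2 first.
- lra.
- lra.
by rewrite /flipy opprB opprK addrAC subrr add0r.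
Qed.
End Walk.

Lemma hung_row_hwall m W H T v x b s : irr_dissection m W H T ->
  hung_row W H T v x (b :: s) -> hwall W H T v x (x + extent W (b :: s)).
Proof. by move=> G r; apply: hwall_flipy; exact: (tile_row_hwall (flipy_irr G) r). Qed.

Lemma hung_row_nseq W H T v x k c :
  hung_row W H T v x (nseq k c) <-> tile_row W T (v - H c) x (nseq k c).
Proof.
elim: k x => [|k IH] x; first by rewrite /hung_row.
by rewrite [nseq _ _]/= hung_row_cons IH.
Qed.

Lemma extent_eq_nseq W k c s : indep W -> extent W s = k%:R * W c -> s = nseq k c.
Proof.
move=> iW; rewrite -extent_nseq => /iW p.
have /all_pred1P -> : all (pred1 c) s by rewrite (perm_all _ p) all_pred1_nseq.
by rewrite (perm_size p) size_nseq.
Qed.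

(* Along the line of height [v], tiles of type [c] hang below and a tile of the
   other type stands above: by independence the lengths never match again. *)
Lemma no_return m W H T c c' x v k b q : irr_dissection m W H T ->
  c != c' -> (0 < k)%N -> hung_row W H T v x (nseq k c) -> T c' x v ->
  T b (x + k%:R * W c) q -> q <= v -> v < q + H b -> False.
Proof.
case: k => // k G cc' _ r t tb q1 q2.
have wall : hwall W H T v x (x + k.+1%:R * W c).
  by rewrite -extent_nseq; exact: (hung_row_hwall G r).
have [|s [_]] := tile_row_block G t wall _ tb q1 q2.
  by rewrite ltrDl mulr_gt0// (width_gt0 G).
move=> /addrI /(extent_eq_nseq (indepW G)) [e _].
by rewrite e eqxx in cc'.
Qed.

(** This is [no_return] after a quarter turn: [transp (flipx W T)] sends [(x, y)] to [(y, - x)], so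
    the tiles [c] stacked to the right of the vertical line hang below its image. *)
Lemma no_returnR m W H T c c' x v k b p : irr_dissection m W H T ->
  c != c' -> (0 < k)%N ->
  (forall i, (i < k)%N -> T c x (v + i%:R * H c)) -> T c' (x - W c') v ->
  T b p (v + k%:R * H c) -> p < x -> x <= p + W b -> False.
Proof.
move=> G cc' k0 col t tb p1 p2.
pose T1 := transp (flipx W T).
apply: (@no_return m H W T1 c c' v (- x) k b (- p - W b)
  (transp_irr (flipx_irr G)) cc' k0).
- elim: k k0 col {tb} => // -[_ _ col|k IH _ col].
    rewrite hung_row_cons; split=> //=; rewrite /T1 /transp /flipx opprB opprK addrAC subrr add0r.
    by have := col 0 isT; rewrite mul0r addr0.
  rewrite -[in nseq _ _]addn1 nseqD hung_row_cat; split.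
    by apply: IH => // i ik; apply: col; rewrite (ltn_trans ik).
  rewrite hung_row_cons; split; last by [].
  rewrite /T1 /transp /flipx opprB opprK addrAC subrr add0r extent_nseq.
  exact: col.
- by rewrite /T1 /transp /flipx opprK.
- by rewrite /T1 /transp /flipx opprB opprK addrAC subrr add0r.
- lra.
- lra.
Qed.

Lemma no_returnL m W H T c c' x v k b p : irr_dissection m W H T ->
  c != c' -> (0 < k)%N ->
  (forall i, (i < k)%N -> T c (x - W c) (v + i%:R * H c)) -> T c' x v ->
  T b p (v + k%:R * H c) -> p <= x -> x < p + W b -> False.
Proof.
move=> G cc' k0 col t tb p1 p2.
apply: (no_returnR (c := c) (c' := c') (x := - x) (v := v) (k := k) (b := b)
  (p := - p - W b) (flipx_irr G)) => //; rewrite ?/flipx.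
- by move=> i /col; rewrite opprK.
- by rewrite opprB opprK addrAC subrr add0r.
- by rewrite opprB opprK addrAC subrr add0r.
- lra.
- lra.
Qed.

(* The vertical sides of the run of [c]'s cannot end, so that the run repeats
   itself upwards indefinitely. *)
Lemma ray m W H T c c' x v k : irr_dissection m W H T -> c != c' -> (0 < k)%N ->
  T c' (x - W c') v -> tile_row W T v x (nseq k c) -> T c' (x + k%:R * W c) v ->
  forall i, tile_row W T (v + i%:R * H c) x (nseq k c).
Proof.
case: k => // k G cc' _ tl r tr i.
(* Strong induction, as [no_returnR] and [no_returnL] need the whole side of the run down to [v]. *)
elim/ltn_ind: i => -[|i] IH; first by rewrite mul0r addr0.
set y := v + _.
have wall : hwall W H T y x (x + k.+1%:R * W c).
  rewrite -extent_nseq; apply: (@hung_row_hwall m W H T y x c (nseq k c)) => //.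
  apply/(@hung_row_nseq W H T y x k.+1 c).
  have -> : y - H c = v + i%:R * H c by rewrite /y -natr1; lra.
  exact: IH.
have [b [p [q [t px xp qy yq]]]] :=
  cover_ne (mesh_gt0 G) (mesh_leW G) (mesh_leH G) (irr_diss G) x y.
have xlt : x < x + k.+1%:R * W c by rewrite ltrDl mulr_gt0// (width_gt0 G).
have qE : q = y.
  apply/eqP; rewrite eq_le qy /= leNgt; apply/negP => /(wall _ _ _ t)/(_ yq).
  by apply=> //; rewrite (le_lt_trans px).
subst q.
(* A tile starting further left would end the left side of the run. *)
have pE : p = x.
  apply/eqP; rewrite eq_le px /= leNgt; apply/negP => px'.
  apply: (no_returnR G cc' (ltn0Sn i) _ tl t px' (ltW xp)).
  by move=> j ji; have /= [] := IH j ji.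
subst p => {px xp qy yq}.
have [s [r1 r2 r3]] := tile_row_walk G t wall xlt.
(* By independence an equal length leaves only the letter [c]; an overshooting tile would end the
   right side of the run. *)
suff e : x + extent W (b :: s) = x + k.+1%:R * W c.
  by move/addrI : e => /(extent_eq_nseq (indepW G)) <-.
apply/eqP; rewrite eq_le r2 andbT leNgt; apply/negP => lt.
apply: (no_returnL G cc' (ltn0Sn i) _ tr (tile_row_last r1)).
- move=> j /IH; rewrite -[nseq _ _]cat0s -addn1 nseqD cat0s tile_row_cat => -[_ /= []].
  by rewrite extent_nseq natrD mulrDl mul1r addrA addrK.
- exact: ltW.
- by rewrite subrK.
Qed.

(** The tile of the column whose vertical range contains [v'] overlaps the tile [c2], because [x]
    and [x'] are less than [m] apart; so it is that tile. Were it not the lowest of the column, [c1]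
    would end the left side at a multiple of [H c], against [no_returnR]. *)
Lemma pure_sepR m W H T c c' x v c1 c2 x' v' : irr_dissection m W H T -> c != c' ->
  T c' (x - W c') v -> (forall k, v + k%:R * H c <= v' -> T c x (v + k%:R * H c)) ->
  T c1 (x' - W c1) v' -> T c2 x' v' -> v <= v' -> `|x - x'| < m ->
  x = x' /\ v = v'.
Proof.
move=> G cc' tl col t1 t2 vv'; rewrite ltr_norml => /andP[xx1 xx2].
have H0 := height_gt0 G c; have m0 := mesh_gt0 G.
pose k := Num.truncn ((v' - v) / H c).
have /andP[k1 k2] : k%:R * H c <= v' - v < (k%:R + 1) * H c.
  rewrite -ler_pdivlMr// -ltr_pdivrMr// natr1; apply: truncn_itv.
  by rewrite divr_ge0 ?subr_ge0// ltW.
have tz : T c x (v + k%:R * H c) by apply: col; lra.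
have := mesh_leW G c; have := mesh_leW G c1; have := mesh_leW G c2 => w2 w1 w.
have := height_gt0 G c1; have := height_gt0 G c2 => h2 h1.
have [||||cE xE vE] := dissection_inj (irr_diss G) tz t2; try lra.
split=> //; subst x'; move: k2 vE t1 {t2 k1 tz}; case: k => [|k] _.
  by rewrite mul0r addr0.
move=> vE t1; exfalso; rewrite -vE in t1.
apply: (no_returnR G cc' (ltn0Sn k) _ tl t1).
- move=> i ik; apply: col; rewrite -vE lerD2l.
  by apply: ler_wpM2r; [exact: ltW|rewrite ler_nat; exact: ltnW].
- by rewrite gtrBl (width_gt0 G).
- by rewrite subrK.
Qed.

Lemma pure_sepL m W H T c c' x v c1 c2 x' v' : irr_dissection m W H T -> c != c' ->
  T c' x v -> (forall k, v + k%:R * H c <= v' -> T c (x - W c) (v + k%:R * H c)) ->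
  T c1 (x' - W c1) v' -> T c2 x' v' -> v <= v' -> `|x - x'| < m ->
  x = x' /\ v = v'.
Proof.
move=> G cc' tr col t1 t2 vv' xx.
have [||||||/oppr_inj -> //] := @pure_sepR m W H (flipx W T) c c' (- x) v c2 c1 (- x') v'
  (flipx_irr G) cc'; rewrite /flipx ?opprB ?opprK ?[_ + _ - W _]addrAC ?subrr ?add0r//.
by rewrite addrC distrC.
Qed.
End Rows.

(** * Words in two letters *)

Section Words.
Implicit Types (s t A B : seq bool) (c : bool) (k : nat).

Definition change s k :=
  [&& (0 < k)%N, (k < size s)%N & nth false s k.-1 != nth false s k].

Lemma change_catP A c B : change (A ++ c :: ~~ c :: B) (size A).+1.
Proof.
apply/and3P; split=> //; first by rewrite size_cat /= addnS !ltnS addnS ltnS leq_addr.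
by rewrite /= !nth_cat ltnn subnn ltnNge leqnSn subSnn; case: c.
Qed.

Lemma run_split c s : exists b B, s = nseq b c ++ B /\ (B = [::] \/ exists B', B = ~~ c :: B').
Proof.
elim: s => [|d s [b [B [-> BE]]]]; first by exists 0, [::]; split=> //; left.
have [e|dc] := eqVneq d c; first by rewrite e; exists b.+1, B.
exists 0, (d :: nseq b c ++ B); split=> //; right; exists (nseq b c ++ B).
by move: dc; case: (c); case: (d).
Qed.

Lemma change_split s k : change s k -> exists A B a b c,
  [/\ s = A ++ nseq a.+1 c ++ nseq b.+1 (~~ c) ++ B, k = (size A + a.+1)%N,
   A = [::] \/ (exists A', A = rcons A' (~~ c)) & B = [::] \/ (exists B', B = c :: B')].
Proof.
case/and3P; case: k => // k _ ks /=.
set c := nth _ _ k => cE.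
have dE : nth false s k.+1 = ~~ c by case: c (nth false s k.+1) cE => -[].
have sE : s = rcons (take k s) c ++ ~~ c :: drop k.+2 s.
  by rewrite -take_nth ?(ltnW ks)// -dE -drop_nth// cat_take_drop.
have [a [A [AE AP]]] := run_split c (rev (take k s)).
have [b [B [BE BP]]] := run_split (~~ c) (drop k.+2 s).
have tE : take k s = rev A ++ nseq a c.
  by rewrite -[LHS]revK AE rev_cat rev_nseq.
exists (rev A), B, a, b, c; split.
- rewrite sE BE tE -cats1 -!catA /=; congr (_ ++ _).
  by elim: (a) => //= n ->.
- rewrite size_rev addnS; congr S.
  have := congr1 size tE; rewrite size_cat size_rev size_nseq => <-.
  by rewrite size_take ltnW.
- case: AP => [->|[A' ->]]; first by left.
  by right; exists (rev A'); rewrite rev_cons.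
- by case: BP => [->|[B' ->]]; [left|right; exists B'; rewrite negbK].
Qed.

Lemma no_change s : (forall k, ~~ change s k) -> s = nseq (size s) (head false s).
Proof.
case: s => // c s h /=; have [b [B [sE [BE|[B' BE]]]]] := run_split c s.
  by rewrite sE BE cats0 size_nseq.
case/negP: (h b.+1); rewrite sE BE.
by have := @change_catP (nseq b c) c B'; rewrite size_nseq -cat_rcons -cats1 -[[:: c]]/(nseq 1 c) -nseqD addn1.
Qed.

(** Applied to the row hung below a row of two runs. The letter counts exclude a constant word; if
    the two maximal runs at a change fill the word, the counts leave only the two orders. *)
Lemma perm_two_runs a b c t : (0 < a)%N -> (0 < b)%N ->
  perm_eq (nseq a c ++ nseq b (~~ c)) t ->
  [\/ t = nseq a c ++ nseq b (~~ c), t = nseq b (~~ c) ++ nseq a c |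
   exists A B i j d, t = A ++ nseq i.+1 d ++ nseq j.+1 (~~ d) ++ B /\
    ((exists A', A = rcons A' (~~ d)) \/ (exists B', B = d :: B'))].
Proof.
move=> a0 b0 p.
have cnt d : count_mem d t = ((c == d) * a + (~~ c == d) * b)%N.
  by rewrite -(permP p) count_cat !count_nseq.
have [/existsP [k ck]|nk] := boolP [exists k : 'I_(size t), change t k]; last first.
  have tE : t = nseq (size t) (head false t).
    apply: no_change => k; apply/negP => ck; have /and3P[_ kt _] := ck.
    by move/existsPn/(_ (Ordinal kt)): nk; rewrite ck.
  have := cnt c; have := cnt (~~ c); rewrite tE !count_nseq eqxx.
  by case: c (head _ _) {cnt p} => -[] /=; lia.
have [A [B [i [j [d [tE _ AP BP]]]]]] := change_split ck.
case: AP => [A0|AP]; last by apply: Or33; exists A, B, i, j, d; split=> //; left.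
case: BP => [B0|BP]; last by apply: Or33; exists A, B, i, j, d; split=> //; right.
move: tE; rewrite A0 B0 /= cats0 => tE.
have := cnt c; have := cnt (~~ c); rewrite tE /= !count_cat /= !count_nseq /=.
have [-> h1 h2|dc] := eqVneq d c; last first.
  have {dc} -> : d = ~~ c by move: dc; case: (d); case: (c).
  rewrite negbK => h1 h2; apply: Or32.
  have -> : a = j.+1 by move: h1 h2; case: (c) => /=; lia.
  by have -> : b = i.+1 by move: h1 h2; case: (c) => /=; lia.
apply: Or31.
have -> : a = i.+1 by move: h1 h2; case: (c) => /=; lia.
by have -> : b = j.+1 by move: h1 h2; case: (c) => /=; lia.
Qed.
End Words.

(** * Rows of tiles standing on a common line *)

Section Floors.
Context {R : realType}.
Implicit Types (W H : bool -> R) (T : bool -> R -> R -> Prop) (s : seq bool).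

Lemma tile_row_flipx W T v x s :
  tile_row W (flipx W T) v x s -> tile_row W T v (- x - extent W s) (rev s).
Proof.
elim: s x => [|b s IH] x //= [t /IH r].
rewrite rev_cons tile_row_rcons extent_cons; split.
  by move: r; congr tile_row; lra.
have -> : extent W (rev s) = extent W s by apply: perm_big; rewrite perm_rev.
by move: t; rewrite /flipx; congr (T b _ v); lra.
Qed.

Section Floor.
Variables (m : R) (W H : bool -> R) (T : bool -> R -> R -> Prop) (N : R).

Definition straddleL v x := exists b q, [/\ T b (x - W b) q, q < v & v < q + H b].
Definition straddleR v x := exists b q, [/\ T b x q, q < v & v < q + H b].
Definition exitL v x := exists b, T b (x - W b) v /\ x - W b <= 0.
Definition exitR v x := exists b, T b x v /\ N <= x + W b.

(** A row that is maximal in the window: it stops where a tile blocks the line or where the next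
    tile reaches a side of the window. *)
Definition floor_row v x s :=
  [/\ s != [::], tile_row W T v x s, 0 < v /\ v < N & 0 < x /\ x + extent W s < N] /\
  (straddleL v x \/ exitL v x) /\ (straddleR v (x + extent W s) \/ exitR v (x + extent W s)).

(* The generic row: the row hanging below it is its reversal. *)
Definition regular v x s :=
  [/\ straddleL v x, straddleR v (x + extent W s) & hung_row W H T v x (rev s)].

Hypothesis G : irr_dissection m W H T.
Let m0 := mesh_gt0 G.
Let mW := mesh_leW G.
Let mH := mesh_leH G.
Let dT := irr_diss G.

Lemma tile_row_prefix v x s s' : tile_row W T v x s -> tile_row W T v x s' ->
  exists t, s' = s ++ t \/ s = s' ++ t.
Proof.
elim: s x s' => [|b s IH] x [|b' s'] /=; first by exists [::]; left.
- by exists (b' :: s'); left.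
- by exists (b :: s); right.
move=> [t r] [t' r']; have e := corner_type m0 mW mH dT t t'; subst b'.
by have [u [->|->]] := IH _ _ r r'; exists u; [left|right].
Qed.

Lemma tile_row_extends b x v : T b x v -> x + W b < N ->
  exists s, [/\ tile_row W T v x (b :: s), x + extent W (b :: s) < N &
    straddleR v (x + extent W (b :: s)) \/ exitR v (x + extent W (b :: s))].
Proof.
have [n] : exists n : nat, N - x < n%:R * m.
  exists (Num.truncn ((N - x) / m)).+1.
  by rewrite -ltr_pdivrMr//; exact: truncnS_gt.
elim: n b x => [|n IH] b x; first by rewrite mul0r => ? _; have := width_gt0 G b; lra.
rewrite -natr1 => le t xN; have Wb := width_gt0 G b; have mb := mW b; have m0' := m0.
have [c [p [q [tc px xp qv vq]]]] := cover_ne m0 mW mH dT (x + W b) v.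
have Hb := height_gt0 G b.
have pE : p = x + W b.
  apply/eqP; rewrite eq_le px /= leNgt; apply/negP => lt.
  by have [||||? ? ?] := dissection_inj dT t tc; [lra..|subst; lra].
subst p.
have [qv'|vq'] := ltP q v.
  exists [::]; rewrite extent_cons extent_nil addr0; split=> //; left; exists c, q.
  by split.
have qE : q = v by apply/eqP; rewrite eq_le qv.
subst q; have [lt|ge] := ltP (x + W b + W c) N; last first.
  exists [::]; rewrite extent_cons extent_nil addr0; split=> //; right; exists c.
  by split.
have [||s [r1 r2 r3]] := IH _ _ _ tc; try lra.
by exists (c :: s); rewrite extent_cons addrA; split.
Qed.

End Floor.

Section FloorTheory.
Variables (m : R) (W H : bool -> R) (T : bool -> R -> R -> Prop) (N : R).
Hypothesis G : irr_dissection m W H T.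
Let m0 := mesh_gt0 G.
Let mW := mesh_leW G.
Let mH := mesh_leH G.
Let dT := irr_diss G.

Lemma floor_row_exists b x v : T b x v -> 0 < x -> x + W b < N -> 0 < v -> v < N ->
  exists x0 s1 s2, floor_row W H T N v x0 (s1 ++ b :: s2) /\ x = x0 + extent W s1.
Proof.
move=> t x_gt0 xN v_gt0 vN.
have [s2 [r1 r2 r3]] := tile_row_extends G t xN.
(* To the left the row is extended in the reflected dissection, where the side [0] of the window
   takes the place of [N]. *)
have [||s1 [l1 l2 l3]] := @tile_row_extends m W H (flipx W T) 0 (flipx_irr G) b (- x - W b) v.
- by rewrite /flipx opprB opprK addrAC subrr add0r.
- lra.
have l4 := tile_row_flipx l1; rewrite extent_cons rev_cons tile_row_rcons in l4.
have e : extent W (rev s1) = extent W s1 by apply: perm_big; rewrite perm_rev.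
rewrite extent_cons in l2 l3.
exists (x - extent W s1), (rev s1), s2; split; last by rewrite e subrK.
have rr : tile_row W T v (x - extent W s1) (rev s1 ++ b :: s2).
  rewrite tile_row_cat e subrK; split=> //; case: l4 => + _.
  by congr tile_row; lra.
have eq1 : x - extent W s1 + extent W (rev s1 ++ b :: s2) = x + extent W (b :: s2).
  by rewrite extent_cat e; lra.
have eq2 c : - (- x - W b + (W b + extent W s1)) - W c = x - extent W s1 - W c by lra.
split; last rewrite eq1; first split=> //.
- by case: (rev s1).
- by split; [lra|rewrite eq1].
split=> //; case: l3 => [[c [q [tc ? ?]]]|[c [tc ?]]]; [left; exists c, q|right; exists c].
  by split=> //; move: tc; rewrite /flipx; congr (T c _ q); lra.
by split; [move: tc; rewrite /flipx; congr (T c _ v)|]; lra.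
Qed.

(** One row cannot begin strictly inside the other: a straddling tile would cross the wall under
    that row, an exiting one would overlap its first tile. The same dichotomy at the right end, in
    [key], excludes a proper prefix. *)
Lemma floor_row_unique v x s x' s' :
  floor_row W H T N v x s -> floor_row W H T N v x' s' ->
  x < x' + extent W s' -> x' < x + extent W s -> x = x' /\ s = s'.
Proof.
wlog: x s x' s' / x <= x'.
  move=> wl f f' h1 h2; have [le|/ltW le] := leP x x'; first exact: wl.
  by have [-> ->] := wl _ _ _ _ le f' f h2 h1.
move=> xx' f f' h1 h2.
have [[sn r _ [x_gt0 _]] [_ eR]] := f; have [[sn' r' _ [x_gt0' _]] [eL' eR']] := f'.
have wall : hwall W H T v x (x + extent W s).
  by case: s sn r {f h2 eR} => // b s _; exact: (tile_row_hwall G).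
have xE : x' = x.
  apply/eqP; rewrite eq_le xx' andbT leNgt; apply/negP => lt.
  case: eL' => [[c [q [tc q1 q2]]]|[c [tc le]]].
    apply: (wall _ _ _ tc) => //; first by have := width_gt0 G c; lra.
    by rewrite subrK.
  case: s sn r {f h2 eR wall} => // b s _ [tb _].
  have Wb := width_gt0 G b; have Hb := height_gt0 G b; have Hc := height_gt0 G c.
  by have [||||? ? ?] := dissection_inj dT tb tc; [lra..|subst; lra].
subst x'; split=> //.
have key t t' b u : tile_row W T v x t' -> t' = t ++ b :: u -> x + extent W t' < N ->
    straddleR H T v (x + extent W t) \/ exitR W T N v (x + extent W t) -> False.
  move=> + e; rewrite e tile_row_cat extent_cat extent_cons => -[_ [tb _]] lt.
  have Wb := width_gt0 G b; have Hb := height_gt0 G b; have su := extent_ge0 G u.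
  case=> [[c [q [tc q1 q2]]]|[c [tc le]]].
    have Wc := width_gt0 G c.
    by have [||||? ? ?] := dissection_inj dT tb tc; [lra..|subst; lra].
  have ? := corner_type m0 mW mH dT tb tc; subst c; lra.
have [[|b u] [e|e]] := tile_row_prefix G r r'; rewrite ?cats0 in e => //.
- by case: (key _ _ _ _ r' e _ eR); case: f' => -[_ _ _ []].
- by case: (key _ _ _ _ r e _ eR'); case: f => -[_ _ _ []].
Qed.
End FloorTheory.
End Floors.

(** * Separation of changes that have a pure column on one side *)

Section Columns.
Context {R : realType}.
Variables (m : R) (W H : bool -> R) (T : bool -> R -> R -> Prop) (B : R).
Hypothesis G : irr_dissection m W H T.

(** The column above the lower change is pure as far as [B], hence past the level of the other
    change. *)
Lemma columns_sepL c x v c' x' v' :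
  T c (x - W c) v -> T (~~ c) x v -> v < B ->
  (forall i, v + i%:R * H c < B -> T c (x - W c) (v + i%:R * H c)) ->
  T c' (x' - W c') v' -> T (~~ c') x' v' -> v' < B ->
  (forall i, v' + i%:R * H c' < B -> T c' (x' - W c') (v' + i%:R * H c')) ->
  `|x - x'| < m -> x = x' /\ v = v'.
Proof.
move=> t1 t2 vB pure t1' t2' vB' pure' xx.
have nc b : b != ~~ b by case: b.
have [le|/ltW le] := leP v v'.
  by apply: (pure_sepL G (nc c) t2 _ t1' t2' le xx) => i iv; apply: pure; exact: le_lt_trans vB'.
rewrite distrC in xx.
have [i iv|-> ->//] := pure_sepL G (nc c') t2' _ t1 t2 le xx.
by apply: pure'; exact: le_lt_trans vB.
Qed.

Lemma columns_sepR c x v c' x' v' :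
  T c (x - W c) v -> T (~~ c) x v -> v < B ->
  (forall i, v + i%:R * H (~~ c) < B -> T (~~ c) x (v + i%:R * H (~~ c))) ->
  T c' (x' - W c') v' -> T (~~ c') x' v' -> v' < B ->
  (forall i, v' + i%:R * H (~~ c') < B -> T (~~ c') x' (v' + i%:R * H (~~ c'))) ->
  `|x - x'| < m -> x = x' /\ v = v'.
Proof.
move=> t1 t2 vB pure t1' t2' vB' pure' xx.
have nc b : ~~ b != b by case: b.
have [le|/ltW le] := leP v v'.
  by apply: (pure_sepR G (nc c) t1 _ t1' t2' le xx) => i iv; apply: pure; exact: le_lt_trans vB'.
rewrite distrC in xx.
have [i iv|-> ->//] := pure_sepR G (nc c') t1' _ t1 t2 le xx.
by apply: pure'; exact: le_lt_trans vB.
Qed.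
End Columns.

(** * Marks of irregular rows and the separation of their keys *)

Section Marks.
Context {R : realType}.
Implicit Types (W H : bool -> R) (T : bool -> R -> R -> Prop) (s : seq bool).

Definition vertex W x s k : R := x + extent W (take k s).

(** Some keys determine only the row; this condition makes [k] a function of the row, with [0] as
    the convention for a row without change. *)
Definition lone s k := (change s k \/ k = 0) /\ forall k', change s k' -> k' = k.

(* The exceptional places of a window, by kind:
   0, 1: a change of type above which the left, right column is pure up to the
   top of the window; 2, 3: the same downwards, for a row with at most one
   change; 4: a crossing whose left column ends at a vertex from which a row of
   equal tiles runs to the left forever; 5, 6: a row cut by the left, right side
   of the window. Two marks of one kind whose keys [z] are close coincide, so
   that each kind has at most linearly many marks. *)
Definition mark_at W H T N (kind : nat) (z v x : R) s k : Prop :=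
  let c := nth false s k.-1 in let d := nth false s k in
  match kind with
  | 0 => [/\ change s k, z = vertex W x s k &
          forall i, v + i%:R * H c < N -> T c (z - W c) (v + i%:R * H c)]
  | 1 => [/\ change s k, z = vertex W x s k &
          forall i, v + i%:R * H d < N -> T d z (v + i%:R * H d)]
  | 2 => [/\ lone s k, x < z, z < x + extent W s & exists a, [/\ T a (z - W a) (v - H a),
          T (~~ a) z (v - H (~~ a)) &
          forall i, 0 < v - i%:R * H a -> T a (z - W a) (v - i%:R * H a - H a)]]
  | 3 => [/\ lone s k, x < z, z < x + extent W s & exists a, [/\ T a (z - W a) (v - H a),
          T (~~ a) z (v - H (~~ a)) &
          forall i, 0 < v - i%:R * H (~~ a) ->
            T (~~ a) z (v - i%:R * H (~~ a) - H (~~ a))]]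
  | 4 => change s k /\ exists j, [/\ z = v + j%:R * H c /\ z < N, (0 < j)%N,
          forall i, (i < j)%N -> T c (vertex W x s k - W c) (v + i%:R * H c),
          T d (vertex W x s k - W d) z &
          forall i, T c (vertex W x s k - W c - i%:R * W c) (z - H c)]
  | 5 => [/\ lone s k, z = v & exitL W T v x]
  | _ => [/\ lone s k, z = v & exitR W T N v (x + extent W s)]
  end.

Definition marked W H T N kind z v x s k :=
  [/\ floor_row W H T N v x s, ~ regular W H T v x s, (k < size s)%N &
      mark_at W H T N kind z v x s k].

Section Theory.
Variables (m : R) (W H : bool -> R) (T : bool -> R -> R -> Prop) (N : R).
Hypothesis G : irr_dissection m W H T.
Let m0 := mesh_gt0 G.
Let mW := mesh_leW G.
Let mH := mesh_leH G.
Let dT := irr_diss G.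

Lemma extent_take_lt s k k' : (k < k')%N -> (k' <= size s)%N ->
  extent W (take k s) < extent W (take k' s).
Proof.
move=> kk ks; have -> : take k' s = take k s ++ take (k' - k) (drop k s).
  by rewrite -[in LHS](subnKC (ltnW kk)) takeD.
rewrite extent_cat ltrDl; apply: (extent_gt0 G).
by rewrite -size_eq0 size_takel ?size_drop ?leq_sub2r// subn_eq0 -ltnNge.
Qed.

Lemma extent_take_inj s k k' : (k < size s)%N -> (k' < size s)%N ->
  extent W (take k s) = extent W (take k' s) -> k = k'.
Proof.
move=> ks ks' e; apply/eqP; rewrite eqn_leq; apply/andP; split; rewrite leqNgt; apply/negP.
  by move=> /extent_take_lt/(_ (ltnW ks)); rewrite e ltxx.
by move=> /extent_take_lt/(_ (ltnW ks')); rewrite e ltxx.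
Qed.

Lemma vertex_bounds x s k : (k < size s)%N ->
  x <= vertex W x s k /\ vertex W x s k < x + extent W s.
Proof.
move=> ks; rewrite lerDl (extent_ge0 G) ltrD2l -{2}[s]take_size.
by split=> //; exact: extent_take_lt.
Qed.

Lemma tile_row_nth v x s k : tile_row W T v x s -> (k < size s)%N ->
  T (nth false s k) (vertex W x s k) v.
Proof.
move=> r ks; move: r; rewrite -{1}(cat_take_drop k s) tile_row_cat => -[_].
by rewrite (drop_nth false ks) => -[].
Qed.

Lemma change_tiles v x s k : tile_row W T v x s -> change s k ->
  [/\ nth false s k = ~~ nth false s k.-1,
   T (nth false s k.-1) (vertex W x s k - W (nth false s k.-1)) v
   & T (nth false s k) (vertex W x s k) v].
Proof.
move=> r /and3P[]; case: k => // k _ ks /= ne; split; last exact: tile_row_nth.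
  by case: (nth false s k.+1) (nth false s k) ne => -[].
have := tile_row_nth r (ltnW ks); rewrite /vertex (take_nth false (ltnW ks)) extent_rcons.
by rewrite addrA addrK.
Qed.

Lemma lone_inj s k k' : lone s k -> lone s k' -> k = k'.
Proof.
move=> [[ck|->] h] [[ck'|->] h'] //; first exact: h'.
- exact: h'.
- by apply/esym/h.
Qed.

Lemma tile_row_common v x s x' s' z : floor_row W H T N v x s -> floor_row W H T N v x' s' ->
  x <= z -> z < x + extent W s -> x' <= z -> z < x' + extent W s' -> x = x' /\ s = s'.
Proof. by move=> f f' *; apply: (floor_row_unique G f f'); lra. Qed.

Lemma change_common v x s k v' x' s' k' :
  floor_row W H T N v x s -> floor_row W H T N v' x' s' ->
  (k < size s)%N -> (k' < size s')%N ->
  vertex W x s k = vertex W x' s' k' -> v = v' -> [/\ v = v', x = x', s = s' & k = k'].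
Proof.
move=> f f' ks ks' e ve; subst v'.
have [h1 h2] := vertex_bounds x ks; have [] := vertex_bounds x' ks'.
rewrite -e => h3 h4; have [? ?] := tile_row_common f f' h1 h2 h3 h4; subst x' s'.
by split=> //; apply: (extent_take_inj ks ks'); move: e => /addrI.
Qed.

Lemma floor_lt v x s : floor_row W H T N v x s -> v < N.
Proof. by case=> -[_ _ [] _]. Qed.

Lemma floor_gt0 v x s : floor_row W H T N v x s -> 0 < v.
Proof. by case=> -[_ _ []]. Qed.

Lemma floor_is_row v x s : floor_row W H T N v x s -> tile_row W T v x s.
Proof. by case=> -[]. Qed.

Lemma marked_uniq kind z v x s k z' v' x' s' k' :
  marked W H T N kind z v x s k -> marked W H T N kind z' v' x' s' k' ->
  `|z - z'| < m -> [/\ v = v', x = x', s = s' & k = k'].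
Proof.
move=> [f nr ks mk] [f' nr' ks' mk'] zz.
have r := floor_is_row f; have r' := floor_is_row f'.
have vN := floor_lt f; have vN' := floor_lt f'.
have v_gt0 := floor_gt0 f; have v_gt0' := floor_gt0 f'.
have fl b p q : flipy H T b p (- q) <-> T b p (q - H b) by rewrite /flipy opprK.
have nv (u : R) : 0 < u -> - u < 0 by lra.
have G' := flipy_irr G.
case: kind mk mk' => [|[|[|[|[|[|kind]]]]]] /=.
- move=> [ck ze pure] [ck' ze' pure'].
  have [d1 t1 t2] := change_tiles r ck; have [d1' t1' t2'] := change_tiles r' ck'.
  rewrite -ze d1 in t1 t2; rewrite -ze' d1' in t1' t2'.
  have [e1 e2] := columns_sepL G t1 t2 vN pure t1' t2' vN' pure' zz.
  by apply: change_common => //; rewrite -ze -ze'.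
- move=> [ck ze pure] [ck' ze' pure'].
  have [d1 t1 t2] := change_tiles r ck; have [d1' t1' t2'] := change_tiles r' ck'.
  rewrite -ze d1 in t1 t2 pure; rewrite -ze' d1' in t1' t2' pure'.
  have [e1 e2] := columns_sepR G t1 t2 vN pure t1' t2' vN' pure' zz.
  by apply: change_common => //; rewrite -ze -ze'.
- move=> [l xz zx [a [t1 t2 pure]]] [l' xz' zx' [a' [t1' t2' pure']]].
  have [||||||||| ze /oppr_inj ve] := @columns_sepL _ m W H (flipy H T) 0 G' a z (- v) a' z' (- v').
  + by rewrite fl.
  + by rewrite fl.
  + exact: nv.
  + move=> i iv; rewrite -[- v + _]opprK fl opprD opprK; apply: pure; lra.
  + by rewrite fl.
  + by rewrite fl.
  + exact: nv.
  + move=> i iv; rewrite -[- v' + _]opprK fl opprD opprK; apply: pure'; lra.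
  + exact: zz.
  subst z' v'; have [? ?] := tile_row_common f f' (ltW xz) zx (ltW xz') zx'.
  by subst x' s'; split=> //; exact: lone_inj l l'.
- move=> [l xz zx [a [t1 t2 pure]]] [l' xz' zx' [a' [t1' t2' pure']]].
  have [||||||||| ze /oppr_inj ve] := @columns_sepR _ m W H (flipy H T) 0 G' a z (- v) a' z' (- v').
  + by rewrite fl.
  + by rewrite fl.
  + exact: nv.
  + move=> i iv; rewrite -[- v + _]opprK fl opprD opprK; apply: pure; lra.
  + by rewrite fl.
  + by rewrite fl.
  + exact: nv.
  + move=> i iv; rewrite -[- v' + _]opprK fl opprD opprK; apply: pure'; lra.
  + exact: zz.
  subst z' v'; have [? ?] := tile_row_common f f' (ltW xz) zx (ltW xz') zx'.
  by subst x' s'; split=> //; exact: lone_inj l l'.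
- move=> [ck [j [[ze _] j0 col td rayl]]] [ck' [j' [[ze' _] j0' col' td' rayl']]].
  have [d1 t1 t2] := change_tiles r ck; have [d1' t1' t2'] := change_tiles r' ck'.
  set c := nth false s k.-1 in d1 t1 ze col rayl; rewrite d1 in t2 td.
  set c' := nth false s' k'.-1 in d1' t1' ze' col' rayl'; rewrite d1' in t2' td'.
  set X := vertex W x s k in t1 t2 col td rayl.
  set X' := vertex W x' s' k' in t1' t2' col' td' rayl'.
  pose T1 := transp (flipx W T).
  have T1E b p q : T1 b p (- q) <-> T b (q - W b) p.
    by rewrite /T1 /transp /flipx opprK.
  (* The rays to the left never end, so any bound beyond both starting points serves. *)
  pose B := Num.max (- X) (- X') + 1.
  have BX : - X < B by rewrite /B ltr_pwDr// le_max lexx.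
  have BX' : - X' < B by rewrite /B ltr_pwDr// le_max lexx orbT.
  have ray1 i : T1 c (z - H c) (- X + i%:R * W c).
    by rewrite -[- X + _]opprK T1E opprD opprK addrAC.
  have ray1' i : T1 c' (z' - H c') (- X' + i%:R * W c').
    by rewrite -[- X' + _]opprK T1E opprD opprK addrAC.
  have [||||||||| zz' /oppr_inj XX] :=
      @columns_sepL _ m H W T1 B (transp_irr (flipx_irr G)) c z (- X) c' z' (- X').
  + by have := ray1 0; rewrite mul0r addr0.
  + by rewrite T1E.
  + exact: BX.
  + by move=> i _; exact: ray1.
  + by have := ray1' 0; rewrite mul0r addr0.
  + by rewrite T1E.
  + exact: BX'.
  + by move=> i _; exact: ray1'.
  + exact: zz.
  have cc : c = c'.
    have := rayl 0; have := rayl' 0; rewrite !mul0r !subr0 -zz' -XX => u' u.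
    have := mW c; have := mW c'; have := mH c; have := mH c'; have := m0 => *.
    by have [||||-> _ _] := dissection_inj dT u u'; [lra..|].
  apply: change_common => //.
  (* Both crossings lie on one vertical line below one vertex. If their heights differed, the upper
     one would start a tile on the right side of the lower column at a multiple of [H c], against
     [no_returnL]. *)
  have lt_absurd v1 v2 i1 i2 : z = v1 + i1%:R * H c -> z = v2 + i2%:R * H c ->
      (forall i, (i < i2)%N -> T c (X - W c) (v2 + i%:R * H c)) ->
      T (~~ c) X v2 -> T (~~ c) X v1 -> (i1 < i2)%N -> False.
    move=> e1 e2 cl u2 u1 lt; have e3 : v1 = v2 + (i2 - i1)%:R * H c.
      by rewrite natrB ?(ltnW lt)//; lra.
    apply: (no_returnL (k := (i2 - i1)%N) (b := ~~ c) (p := X) (c := c) G _ _ _ u2) => [||i ii||| ].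
    - by case: (c).
    - by rewrite subn_gt0.
    - by apply: cl; rewrite (leq_trans ii)// leq_subr.
    - by rewrite -e3; exact: u1.
    - exact: lexx.
    - by rewrite ltrDl (width_gt0 G).
  rewrite -cc -XX -zz' in ze' col' t2'.
  case: (ltngtP j j') => [lt|lt|e].
  + by case: (lt_absurd _ _ _ _ ze ze' col' t2' t2 lt).
  + by case: (lt_absurd _ _ _ _ ze' ze col t2 t2' lt).
  + by rewrite e in ze; lra.
(* Both exiting tiles contain the abscissa [0], so they overlap as soon as their heights are less
   than [m] apart. *)
- move=> [l ze [b [tb le]]] [l' ze' [b' [tb' le']]]; subst z z'.
  have x_gt0 : 0 < x by case: f => -[_ _ _ []].
  have x_gt0' : 0 < x' by case: f' => -[_ _ _ []].
  move: zz; rewrite ltr_norml => /andP[? ?]; have := mH b; have := mH b' => *.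
  have [||||be xe ve] := dissection_inj dT tb tb'; [lra..|].
  subst v' b'; move: xe => /addIr xe; subst x'.
  have [||] := floor_row_unique G f f'; rewrite ?ltrDl ?(extent_gt0 G)//.
  + by case: f' => -[].
  + by case: f => -[].
  by move=> _ se; subst s'; split=> //; exact: lone_inj l l'.
- move=> [l ze [b [tb le]]] [l' ze' [b' [tb' le']]]; subst z z'.
  have xN : x + extent W s < N by case: f => -[_ _ _ []].
  have xN' : x' + extent W s' < N by case: f' => -[_ _ _ []].
  have sn : s != [::] by case: f => -[].
  have sn' : s' != [::] by case: f' => -[].
  move: zz; rewrite ltr_norml => /andP[? ?]; have := mH b; have := mH b' => *.
  have [||||be xe ve] := dissection_inj dT tb tb'; [lra..|].
  subst v' b'; have := extent_gt0 G sn; have := extent_gt0 G sn' => *.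
  have [||? ?] := floor_row_unique G f f'; [lra..|].
  by subst x' s'; split=> //; exact: lone_inj l l'.
Qed.

(** With the separation of keys, this leaves finitely many slots of length [m] per kind, each
    holding at most one mark. *)
Lemma marked_bounds kind z v x s k : marked W H T N kind z v x s k -> 0 <= z /\ z < N.
Proof.
move=> [f nr ks]; have [h1 h2] := vertex_bounds x ks.
have [[_ _ [v_gt0 vN] [x_gt0 xN]] _] := f.
case: kind => [|[|[|[|[|[|kind]]]]]] /=.
- by move=> [_ -> _]; split; lra.
- by move=> [_ -> _]; split; lra.
- by move=> [_ ? ? _]; split; lra.
- by move=> [_ ? ? _]; split; lra.
- move=> [_ [j [[ze zN] _ _ _ _]]]; split=> //; rewrite ze.
  by rewrite addr_ge0 ?mulr_ge0 ?ler0n ?(ltW v_gt0) ?(ltW (height_gt0 G _)).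
- by move=> [_ -> _]; split; lra.
- by move=> [_ -> _]; split; lra.
Qed.
End Theory.
End Marks.

(** * Every change of an irregular row carries a mark *)

Section Complete.
Context {R : realType}.
Implicit Types (W H : bool -> R) (T : bool -> R -> R -> Prop) (s : seq bool).

(** The run of [c] is enclosed, so [ray] repeats it; the column asserted here is the last one of the
    repeated run. *)
Lemma ray_before m W H T v x A a c b B : irr_dissection m W H T ->
  tile_row W T v x (A ++ nseq a.+1 c ++ nseq b.+1 (~~ c) ++ B) ->
  (exists A', A = rcons A' (~~ c)) ->
  forall i, T c (x + extent W A + a.+1%:R * W c - W c) (v + i%:R * H c).
Proof.
move=> G + [A' AE] i; rewrite AE !tile_row_cat tile_row_rcons => -[[_ tl] [r [[tr _] _]]].
have := @ray _ m W H T c (~~ c) (x + extent W A) v a.+1 G; rewrite AE.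
move=> /(_ _ isT _ r); rewrite extent_nseq in tr.
have -> : c != ~~ c by case: (c).
move=> /(_ isT); rewrite {1}extent_rcons addrA addrK => /(_ tl tr i).
rewrite -[in nseq _ _]addn1 nseqD tile_row_cat extent_nseq => -[_ [+ _]].
by congr T; rewrite -natr1 mulrDl mul1r addrA addrK.
Qed.

Lemma ray_after m W H T v x A a c b B : irr_dissection m W H T ->
  tile_row W T v x (A ++ nseq a.+1 c ++ nseq b.+1 (~~ c) ++ B) ->
  (exists B', B = c :: B') ->
  forall i, T (~~ c) (x + extent W A + a.+1%:R * W c) (v + i%:R * H (~~ c)).
Proof.
move=> G + [B' BE] i; rewrite BE !tile_row_cat !extent_nseq => -[_ [r [r2 [tr _]]]].
have := @ray _ m W H T (~~ c) c (x + extent W A + a.+1%:R * W c) v b.+1 G.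
move=> /(_ _ isT _ r2 tr).
have -> : ~~ c != c by case: (c).
move=> /(_ isT); suff tl : T c (x + extent W A + a.+1%:R * W c - W c) v.
  by move=> /(_ tl i) [].
move: r; rewrite -[in nseq _ _]addn1 nseqD tile_row_cat extent_nseq => -[_ [+ _]].
by congr T; rewrite -natr1 mulrDl mul1r addrA addrK.
Qed.

(** Where the column first fails, [no_returnL] forbids a tile that starts at this level to cross the
    line [z]. A tile therefore ends exactly at [z], and its type is not [c] by the choice of [j]. *)
Lemma column_or_block m W H T c z v B : irr_dissection m W H T ->
  T c (z - W c) v -> T (~~ c) z v ->
  (forall i, v + i%:R * H c < B -> T c (z - W c) (v + i%:R * H c)) \/
  exists j, [/\ (0 < j)%N, forall i, (i < j)%N -> T c (z - W c) (v + i%:R * H c),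
    v + j%:R * H c < B & T (~~ c) (z - W (~~ c)) (v + j%:R * H c)].
Proof.
move=> G t1 t2; have [?|nall] := EM (forall i, v + i%:R * H c < B -> T c (z - W c) (v + i%:R * H c)).
  by left.
right; have ex : exists j, `[< v + j%:R * H c < B /\ ~ T c (z - W c) (v + j%:R * H c) >].
  apply: contrapT => nj; apply: nall => i iB; apply: contrapT => nt.
  by apply: nj; exists i; apply/asboolP.
have [j /asboolP[jB nt] jmin] := ex_minnP ex.
have j0 : (0 < j)%N.
  by rewrite lt0n; apply/eqP => j0; apply: nt; rewrite j0 mul0r addr0.
have col i : (i < j)%N -> T c (z - W c) (v + i%:R * H c).
  move=> ij; apply: contrapT => nti; move: (ij); rewrite ltnNge => /negP; apply.
  apply: jmin; apply/asboolP; split=> //; apply: le_lt_trans jB.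
  by rewrite lerD2l ler_wpM2r ?ler_nat ?(ltnW ij)// ltW// (height_gt0 G).
exists j; split=> //.
pose T1 := transp (flipx W T).
have T1E b p q : T1 b p (- q) <-> T b (q - W b) p by rewrite /T1 /transp /flipx opprK.
have G1 : irr_dissection m H W T1 := transp_irr (flipx_irr G).
have nc : c != ~~ c by case: (c).
have [|||||b] := @tile_row_step _ m H W T1 G1 c (v + j.-1%:R * H c) (- z) (v + j%:R * H c) (- z).
- by rewrite T1E; apply: col; rewrite prednK.
- by rewrite -[in RHS](prednK j0) -natr1 mulrDl mul1r addrA.
- exact: lexx.
- by rewrite ltrDl (width_gt0 G).
- move=> b q p; rewrite /T1 /transp /flipx => tb p1 p2 q1 q2.
  have qE : q = v + j%:R * H c.
    apply/eqP; rewrite eq_le q1 leNgt; apply/negP => lt.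
    have tj := col j.-1; rewrite prednK// in tj; have {}tj := tj (leqnn _).
    have e : v + j%:R * H c = v + j.-1%:R * H c + H c.
      by rewrite -[in LHS](prednK j0) -natr1 mulrDl mul1r addrA.
    have Wc := width_gt0 G c; have Hc := height_gt0 G c.
    by have [||||? ? ?] := dissection_inj (irr_diss G) tj tb; [lra..|subst; lra].
  rewrite qE in tb; apply: (no_returnL G nc j0 col t2 tb); lra.
rewrite T1E; have [->|bc] := eqVneq b c; first by [].
by have -> : b = ~~ c by move: bc; case: (b); case: (c).
Qed.

Lemma tile_row_nseq W T v x k c : (forall i, (i < k)%N -> T c (x + i%:R * W c) v) ->
  tile_row W T v x (nseq k c).
Proof.
elim: k => // k IH h; rewrite -[in nseq _ _]addn1 nseqD tile_row_cat; split.
  by apply: IH => i ik; apply: h; exact: ltnW.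
by rewrite extent_nseq; split=> //; exact: h.
Qed.

Lemma change_two_runs a b c k : change (nseq a c ++ nseq b (~~ c)) k -> k = a.
Proof.
case/and3P => k0; rewrite size_cat !size_nseq => ks.
rewrite !nth_cat !size_nseq !nth_nseq.
case: (ltngtP k a) => // ka.
  by rewrite (leq_ltn_trans (leq_pred k) ka) eqxx.
have -> : (k.-1 < a)%N = false by apply/negbTE; rewrite -leqNgt; lia.
by rewrite !ifT ?eqxx//; lia.
Qed.

Section Marking.
Variables (m : R) (W H : bool -> R) (T : bool -> R -> R -> Prop) (N : R).
Hypothesis G : irr_dissection m W H T.

(** The straddling tiles bound the line from below as well, so the hanging row has the same
    extent. *)
Lemma ceiling v x s : tile_row W T v x s -> s != [::] -> straddleL W H T v x ->
  straddleR H T v (x + extent W s) -> exists t, hung_row W H T v x t /\ perm_eq s t.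
Proof.
case: s => // b s r _ [c [q [tc q1 q2]]] [c' [q' [tc' q1' q2']]].
have wall := tile_row_hwall G r.
have wall' : hwall W H (flipy H T) (- v) x (x + extent W (b :: s)).
  by apply: hwall_flipy; rewrite opprK; move: wall; rewrite /hwall /flipy => wall b0 p0 q0; rewrite opprB opprK addrAC subrr add0r; apply: wall.
have xlt : x < x + extent W (b :: s) by rewrite ltrDl (extent_gt0 G).
have [|||||d td] := @tile_row_step _ m W H (flipy H T) (flipy_irr G) c (x - W c) (- q - H c) x (- v).
- by rewrite /flipy opprB opprK addrAC subrr add0r.
- by rewrite subrK.
- lra.
- lra.
- move=> d p q0 t0 h1 h2 h3 h4; apply: (wall' _ _ _ t0) => //; lra.
have [|||t [r1 e]] := @tile_row_block _ m W H (flipy H T) (flipy_irr G) d x (- v) _ c' (- q' - H c') td wall' xlt.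
- by rewrite /flipy opprB opprK addrAC subrr add0r.
- lra.
- lra.
exists (d :: t); split=> //; apply: (indepW G); move/addrI : e => //.
Qed.

(** Four tiles meet at [z]. If the left column is pure neither up to [N] (kind 0) nor down to [0]
    (kind 2), it is a vertical run of [c] closed by the other type at both ends, and the
    quarter-turned [ray] sends it to the left: kind 4. *)
Lemma marked_crossing v x a b c : let s := nseq a.+1 c ++ nseq b.+1 (~~ c) in
  let z := vertex W x s a.+1 in
  tile_row W T v x s -> v < N -> hung_row W H T v x s ->
  change s a.+1 -> lone s a.+1 -> x < z -> z < x + extent W s ->
  exists kind, exists y, (kind < 7)%N /\ mark_at W H T N kind y v x s a.+1.
Proof.
move=> s z r vN rD ck lk xz zx.
have [ndc tl tr] := change_tiles r ck; rewrite -/z in tl tr.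
have cE : nth false s a.+1.-1 = c by rewrite /s nth_cat size_nseq ltnSn nth_nseq ltnSn.
rewrite ndc cE in tl tr.
have zE : z = x + a.+1%:R * W c.
  by rewrite /z /vertex /s take_size_cat ?size_nseq// extent_nseq.
have [dl dr] : T c (z - W c) (v - H c) /\ T (~~ c) z (v - H (~~ c)).
  move: rD; rewrite hung_row_cat extent_nseq -zE => -[+ [tr2 _]].
  rewrite hung_row_nseq -[in nseq _ _]addn1 nseqD tile_row_cat extent_nseq => -[_ [tl2 _]].
  split; last by move: tr2; rewrite /flipy opprK.
  by move: tl2; congr T; rewrite zE -natr1 mulrDl mul1r addrA addrK.
have [up|[j [j0 up jN tj]]] := column_or_block N G tl tr.
  by exists 0, z; split=> //=; rewrite cE; split.
have fl e p q : flipy H T e p (- q) <-> T e p (q - H e) by rewrite /flipy opprK.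
have [||down|[i [i0 down _ ti]]] :=
    @column_or_block m W H (flipy H T) c z (- v) 0 (flipy_irr G).
- by rewrite fl.
- by rewrite fl.
- exists 2, z; split=> //=; split=> //; exists c; split=> // i iv.
  by rewrite -fl opprB [_ - v]addrC; apply: down; lra.
have down' n : (n < i)%N -> T c (z - W c) (v - n.+1%:R * H c).
  move=> /down; rewrite -[- v + _]opprK fl; congr T.
  by rewrite -natr1 mulrDl mul1r; lra.
have {}ti : T (~~ c) (z - W (~~ c)) (v - i%:R * H c - H (~~ c)).
  by move: ti; rewrite -[- v + _]opprK fl; congr T; lra.
pose T1 := transp (flipx W T).
have T1E e p q : T1 e p (- q) <-> T e (q - W e) p by rewrite /T1 /transp /flipx opprK.
have col n : (n < i + j)%N -> T c (z - W c) (v - i%:R * H c + n%:R * H c).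
  move=> nij; have [ni|le] := ltnP n i.
    have lt : ((i - n).-1 < i)%N by lia.
    have := down' _ lt; rewrite prednK ?subn_gt0// natrB ?(ltnW ni)//.
    by congr T; rewrite mulrBl; lra.
  have lt : (n - i < j)%N by lia.
  by have := up _ lt; rewrite natrB//; congr T; rewrite mulrBl; lra.
have rays n : T c (z - W c - n%:R * W c) (v + j%:R * H c - H c).
  have nc : c != ~~ c by case: (c).
  have ij : (0 < i + j)%N by rewrite addn_gt0 i0.
  have h1 : T1 (~~ c) (v - i%:R * H c - H (~~ c)) (- z) by rewrite T1E.
  have h2 : tile_row H T1 (- z) (v - i%:R * H c) (nseq (i + j) c).
    by apply: tile_row_nseq => l lij; rewrite T1E; apply: col.
  have h3 : T1 (~~ c) (v - i%:R * H c + (i + j)%:R * H c) (- z).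
    by rewrite T1E; move: tj; congr T; rewrite natrD mulrDl; lra.
  have := ray (transp_irr (flipx_irr G)) nc ij h1 h2 h3 n.
  rewrite -(prednK ij) -addn1 nseqD tile_row_cat extent_nseq => -[_ [+ _]].
  rewrite /T1 /transp /flipx; congr T; first by lra.
  have -> : (i + j).-1 = (i + j - 1)%N by lia.
  by rewrite natrB// natrD; lra.
exists 4, (v + j%:R * H c); split=> //; rewrite /mark_at ndc cE.
by split=> //; exists j; split.
Qed.

Lemma lone_nseq k c : lone (nseq k c) 0.
Proof.
split; first by right.
move=> i ci; have := @change_two_runs k 0 c i; rewrite cats0 => /(_ ci) ik.
by move: ci; rewrite ik /change size_nseq ltnn andbF.
Qed.

(** A constant word equals each of its permutations and its reversal, so only a side of the window
    can make the row irregular. *)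
Lemma marked_nseq v x k c : floor_row W H T N v x (nseq k c) ->
  ~ regular W H T v x (nseq k c) ->
  exists kind, exists z, (kind < 7)%N /\ marked W H T N kind z v x (nseq k c) 0.
Proof.
move=> f nr; have [[sn r _ _] [eL eR]] := f.
have k0 : (0 < size (nseq k c))%N by rewrite lt0n size_eq0.
have l0 := lone_nseq k c.
case: eL => [eL|eL]; last by exists 5, v; split=> //; split.
case: eR => [eR|eR]; last by exists 6, v; split=> //; split.
have [t [rt p]] := ceiling r sn eL eR; case: nr; split=> //.
have /all_pred1P tE : all (pred1 c) t by rewrite -(perm_all _ p) all_pred1_nseq.
by move: rt; rewrite tE -(perm_size p) size_nseq rev_nseq.
Qed.

Lemma marked_complete v x s k : floor_row W H T N v x s -> ~ regular W H T v x s ->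
  change s k ->
  exists kind, exists z, (kind < 7)%N /\ marked W H T N kind z v x s k.
Proof.
move=> f nr ck; have [[sn r [_ vN] [x_gt0 xN]] [eL eR]] := f.
have ks : (k < size s)%N by case/and3P: ck.
suff [kind [z [? ?]]] : exists kind, exists z, (kind < 7)%N /\ mark_at W H T N kind z v x s k.
  by exists kind, z; split=> //; split.
have [A [B [a [b [c [sE kE AP BP]]]]]] := change_split ck.
have tE : take k s = A ++ nseq a.+1 c.
  by rewrite sE catA take_size_cat// size_cat size_nseq.
have cE : nth false s k.-1 = c.
  rewrite -(nth_take (n0 := k)); last by rewrite kE addnS.
  by rewrite tE kE addnS nth_cat ltnNge leq_addr addKn nth_nseq ltnSn.
have dE : nth false s k = ~~ c.
  by rewrite sE catA nth_cat size_cat size_nseq kE ltnn subnn.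
have zE : vertex W x s k = x + extent W A + a.+1%:R * W c.
  by rewrite /vertex tE extent_cat extent_nseq addrA.
case: AP => [A0|AP]; last first.
  exists 0, (vertex W x s k); split=> //; rewrite /mark_at cE; split=> // i _.
  by rewrite zE; move: i; rewrite sE in r; exact: (ray_before G r AP).
case: BP => [B0|BP]; last first.
  exists 1, (vertex W x s k); split=> //; rewrite /mark_at dE; split=> // i _.
  by rewrite zE; move: i; rewrite sE in r; exact: (ray_after G r BP).
rewrite A0 B0 cats0 cat0s in sE; rewrite A0 add0n in kE.
have lk : lone s k.
  by split; [left|rewrite sE kE => k'; exact: change_two_runs].
case: eL => [eL|eL]; last by exists 5, v; split.
case: eR => [eR|eR]; last by exists 6, v; split.
have [t [rt p]] := ceiling r sn eL eR.
have p' := p; rewrite sE in p'.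
case: (perm_two_runs _ _ p') => // [te|te|[A2 [B2 [i [j [d [te D]]]]]]].
- have [xz zx] := vertex_bounds G x ks.
  have {}xz : x < vertex W x s k by rewrite zE A0 extent_nil addr0 ltrDl mulr_gt0// (width_gt0 G).
  rewrite te -sE in rt; rewrite kE in ck lk xz zx *.
  by move: r rt ck lk xz zx; rewrite sE => *; exact: marked_crossing.
- by case: nr; split=> //; rewrite sE rev_cat !rev_nseq -te.
(* The key is the change of the hanging row [t], next to its enclosed run, while [k] remains the
   change of [s]. *)
pose z := x + extent W A2 + i.+1%:R * W d.
have G' := flipy_irr G.
have szs : extent W s = extent W A2 + i.+1%:R * W d + j.+1%:R * W (~~ d) + extent W B2.
  have -> : extent W s = extent W t by apply: perm_big.
  by rewrite te !extent_cat !extent_nseq !addrA.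
have Wd e n : 0 < n.+1%:R * W e by rewrite mulr_gt0// (width_gt0 G).
have xz : x < z by rewrite /z; have := extent_ge0 G A2; have := Wd d i; lra.
have zx : z < x + extent W s.
  by rewrite szs /z; have := extent_ge0 G B2; have := Wd (~~ d) j; lra.
rewrite te in rt.
have fl e q u : flipy H T e q (- u) <-> T e q (u - H e) by rewrite /flipy opprK.
have [dl dr] : T d (z - W d) (v - H d) /\ T (~~ d) z (v - H (~~ d)).
  move: (rt); rewrite !hung_row_cat !extent_nseq -/z => -[_ [+ [[+ _] _]]].
  rewrite hung_row_nseq -[in nseq _ _]addn1 nseqD tile_row_cat extent_nseq fl => -[_ [+ _]].
  by move=> h1 h2; split=> //; move: h1; congr T; rewrite /z -natr1; lra.
case: D => D.
  exists 2, z; split=> //; split=> //; exists d; split=> // n _.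
  have := @ray_before m W H _ (- v) x A2 i d j B2 G' rt D n.
  by rewrite -/z -[- v + _]opprK fl; congr T; lra.
exists 3, z; split=> //; split=> //; exists d; split=> // n _.
have := @ray_after m W H _ (- v) x A2 i d j B2 G' rt D n.
by rewrite -/z -[- v + _]opprK fl; congr T; lra.
Qed.
End Marking.
End Complete.

(** * Counting the sign patterns of affine functions *)

Section SignCode.
Context {R : realType}.

Definition affine d (f : ('I_d -> R) -> R) :=
  exists a b, forall x, f x = b + \sum_i a i * x i.

Definition same_sign d (fs : seq (('I_d -> R) -> R)) x y :=
  forall f, List.In f fs -> Num.sg (f x) = Num.sg (f y).

Lemma affine_segment d (f : ('I_d -> R) -> R) x y t : affine f ->
  f (fun i => x i + t * (y i - x i)) = f x + t * (f y - f x).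
Proof.
move=> [a [b fE]]; rewrite !fE.
have -> : \sum_i a i * (x i + t * (y i - x i)) =
    \sum_i a i * x i + t * (\sum_i a i * y i - \sum_i a i * x i).
  by rewrite -sumrB mulr_sumr -big_split /=; apply: eq_bigr => i _; ring.
ring.
Qed.

Lemma sg_segment (u v t : R) : Num.sg u = Num.sg v -> 0 < t < 1 ->
  Num.sg (u + t * (v - u)) = Num.sg u.
Proof.
move=> uv /andP[t0 t1]; have -> : u + t * (v - u) = (1 - t) * u + t * v by ring.
have t1' : 0 < 1 - t by rewrite subr_gt0.
case: (sgrP u) uv => hu; case: (sgrP v) => hv; try lra; move=> _.
- by rewrite hu hv !mulr0 addr0 sgr0.
- by rewrite gtr0_sg// addr_gt0// mulr_gt0.
- by rewrite ltr0_sg// -oppr_gt0 opprD addr_gt0// -mulrN mulr_gt0// oppr_gt0.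
Qed.

(* Solves [b + sum_i a_i x_i = 0] for the variable of index [j]. *)
Definition plug d (a : 'I_d.+1 -> R) b j (z : 'I_d -> R) (i : 'I_d.+1) : R :=
  if unlift j i is Some k then z k
  else - (b + \sum_k a (lift j k) * z k) / a j.

Lemma plug_lift d (a : 'I_d.+1 -> R) b j z k : plug a b j z (lift j k) = z k.
Proof. by rewrite /plug liftK. Qed.

Lemma plug_self d (a : 'I_d.+1 -> R) b j z :
  plug a b j z j = - (b + \sum_k a (lift j k) * z k) / a j.
Proof. by rewrite /plug unlift_none. Qed.

Lemma sum_lift d (F : 'I_d.+1 -> R) j :
  \sum_i F i = F j + \sum_k F (lift j k).
Proof. exact: bigD1_ord. Qed.

Lemma plugK d (a : 'I_d.+1 -> R) b j x : a j != 0 -> b + \sum_i a i * x i = 0 ->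
  plug a b j (fun k => x (lift j k)) = x.
Proof.
move=> aj e; apply/funext => i; rewrite /plug.
case: unliftP => [k ->//|->]; apply: (mulfI aj).
by rewrite mulrC mulfVK//; move: e; rewrite (sum_lift _ j); lra.
Qed.

Lemma affine_plug d (a : 'I_d.+1 -> R) b j (g : ('I_d.+1 -> R) -> R) :
  affine g -> affine (g \o plug a b j).
Proof.
move=> [a' [b' gE]].
exists (fun k => a' (lift j k) - a' j * a (lift j k) / a j), (b' - a' j * b / a j) => z /=.
rewrite gE (sum_lift _ j).
rewrite (eq_bigr (fun k => a' (lift j k) * z k)); last by move=> k _; rewrite plug_lift.
rewrite plug_self.
rewrite [in RHS](eq_bigr (fun k => a' (lift j k) * z k - a' j * a (lift j k) / a j * z k)).
  rewrite sumrB.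
  have -> : \sum_i a' j * a (lift j i) / a j * z i =
      a' j / a j * \sum_i a (lift j i) * z i.
    by rewrite mulr_sumr; apply: eq_bigr => i _; ring.
  ring.
by move=> k _; ring.
Qed.

(* Crossing the hyperplane [f = 0] splits only those sign patterns of the other
   functions that occur on the hyperplane, by convexity; hence the recursion
   [Q(P+1,d) = Q(P,d) + 2 Q(P,d-1)]. *)
Lemma sign_code d (fs : seq (('I_d -> R) -> R)) :
  (forall f, List.In f fs -> affine f) ->
  exists c : ('I_d -> R) -> nat,
    (forall x, (c x < (2 * size fs + 1) ^ d)%N) /\
    (forall x y, c x = c y -> same_sign fs x y).
Proof.
move e: (size fs) => n; elim: n d fs e => [|n IH] d [|f fs] //= => [_ aff|[extent_fs] aff].
  by exists (fun=> 0); split=> [x|x y _ f []]; rewrite expn_gt0 addn1.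
have affs g : List.In g fs -> affine g by move=> gi; apply: aff; right.
have [a [b fE]] : affine f by apply: aff; left.
have [c1 [c1lt c1P]] := IH d fs extent_fs affs.
have mono : ((2 * n + 1) ^ d <= (2 * n.+1 + 1) ^ d)%N.
  by case: (d) => // d'; rewrite leq_exp2r//; lia.
destruct d as [|d].
  exists (fun=> 0); split=> // x y _ g _; congr (Num.sg (g _)).
  by apply/funext => -[].
have [/existsP[j aj]|na] := boolP [exists j, a j != 0]; last first.
  exists c1; split=> [x|x y e g [<-|gi]]; last exact: c1P.
    exact: leq_trans mono.
  suff fc z : f z = b by rewrite !fc.
  rewrite fE big1 ?addr0// => i _; move/existsPn: na => /(_ i); rewrite negbK => /eqP->.
  by rewrite mul0r.
(* [phi] parametrizes the hyperplane [f = 0] by one variable fewer. *)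
pose phi := plug a b j; pose gs := [seq g \o phi | g <- fs].
have gsP h : List.In h gs -> exists2 g, List.In g fs & h = g \o phi.
  rewrite /gs; elim: (fs) => //= g l IHl [<-|/IHl[g' g'l ->]]; first by exists g; [left|].
  by exists g'; [right|].
have gsI g : List.In g fs -> List.In (g \o phi) gs.
  by rewrite /gs; elim: (fs) => //= g' l IHl [->|/IHl]; [left|right].
have extent_gs : size gs = n by rewrite size_map.
have [|c2 [c2lt c2P]] := IH d gs extent_gs.
  by move=> h /gsP[g /affs ag ->]; exact: affine_plug.
(* The pattern of [fs] at [x] also occurs on the hyperplane; [zeta] chooses a witness there. *)
pose real x := exists z, same_sign fs (phi z) x.
have [zeta zetaP] : exists zeta, forall x, real x -> same_sign fs (phi (zeta x)) x.
  suff : forall x, exists z, real x -> same_sign fs (phi z) x.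
    by move=> h; have [zeta zP] := choice h; exists zeta.
  move=> x; have [[z zx]|nr] := EM (real x); first by exists z.
  by exists (fun=> 0).
have real_zero x : f x = 0 -> real x.
  move=> fx; exists (fun k => x (lift j k)); rewrite /phi plugK//; last by rewrite -fE.
have real_same x y : same_sign fs x y -> real x -> real y.
  move=> xy [z zx]; exists z => g gi; rewrite zx//; exact: xy.
have real_segment x y : same_sign fs x y -> f x < 0 -> 0 < f y -> real x.
  move=> xy fx fy; pose t := f x / (f x - f y).
  have t1 : 0 < t < 1.
    by rewrite /t ltr_ndivlMr ?ltr_ndivrMr ?mul0r ?mul1r; lra.
  pose w i := x i + t * (y i - x i).
  have fw : f w = 0.
    have af : affine f by exists a, b.
    have fxy : f x - f y != 0 by rewrite subr_eq0 lt_eqF// (lt_trans fx).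
    by rewrite (affine_segment x y t af) /t; field.
  apply: (real_same w x _ (real_zero w fw)) => g gi; rewrite (affine_segment x y t (affs g gi)).
  by rewrite sg_segment//; exact: xy.
pose Q1 := ((2 * n + 1) ^ d.+1)%N; pose Q2 := ((2 * n + 1) ^ d)%N.
pose K x := `[< real x >] && (f x != 0).
(* Codes below [Q1] come from [c1]; two further blocks of length [Q2] serve the two signs of [f] on
   patterns that occur on the hyperplane. Outside these blocks [f] vanishes or its sign is fixed by
   the pattern, as a segment on which it changed sign would meet the hyperplane. *)
pose c x := if K x then
  (if 0 < f x then (Q1 + Q2 + c2 (zeta x))%N else (Q1 + c2 (zeta x))%N) else c1 x.
have le : (Q1 + Q2 + Q2 <= (2 * n.+1 + 1) ^ d.+1)%N.
  rewrite /Q1 /Q2 !expnS; set u := ((2 * n + 1) ^ d)%N.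
  have : (u <= (2 * n.+1 + 1) ^ d)%N.
    by rewrite /u; case: (d) => // d'; rewrite leq_exp2r//; lia.
  set u' := ((2 * n.+1 + 1) ^ d)%N; nia.
exists c; split=> [x|x y].
  apply: leq_trans le; rewrite /c.
  have := c2lt (zeta x); rewrite -/Q2 => lt2; have := c1lt x; rewrite -/Q1 => lt1.
  by case: ifP => _; [case: ifP => _|]; lia.
have same2 u v : real u -> real v -> c2 (zeta u) = c2 (zeta v) -> same_sign fs u v.
  move=> ru rv /c2P e g gi; rewrite -(zetaP _ ru) // -(zetaP _ rv)//.
  exact: (e _ (gsI g gi)).
have same1 u v : ~~ (`[< real u >] && (f u != 0)) -> ~~ (`[< real v >] && (f v != 0)) ->
    same_sign fs u v -> Num.sg (f u) = Num.sg (f v).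
  move=> nu nv uv; have vu : same_sign fs v u by move=> g gi; rewrite uv.
  have [ru|nru] := EM (real u).
    have rv := real_same _ _ uv ru; move: nu nv; rewrite !asboolT//= !negbK.
    by move=> /eqP -> /eqP ->.
  have nrv : ~ real v by move/(real_same _ _ vu).
  case: (ltgtP (f u) 0) => [fu|fu|/real_zero//]; case: (ltgtP (f v) 0) => [fv|fv|/real_zero//].
  - by rewrite !ltr0_sg.
  - by case: nru; exact: real_segment uv fu fv.
  - by case: nrv; exact: real_segment vu fv fu.
  - by rewrite !gtr0_sg.
have := c1lt x; rewrite -/Q1; have := c1lt y; rewrite -/Q1.
have := c2lt (zeta x); rewrite -/Q2; have := c2lt (zeta y); rewrite -/Q2.
rewrite /c; case: (boolP (K x)) => cx; case: (boolP (K y)) => cy.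
- move: cx cy => /andP[/asboolP rx fx] /andP[/asboolP ry fy] lt2 lt2' _ _.
  case: ifP => sx; case: ifP => sy e; try (exfalso; lia).
    move=> g [<-|gi]; first by rewrite !gtr0_sg.
    by apply: (same2 x y) => //; lia.
  move=> g [<-|gi]; last by apply: (same2 x y) => //; lia.
  have nx : f x < 0 by rewrite lt_neqAle fx leNgt sx.
  have ny : f y < 0 by rewrite lt_neqAle fy leNgt sy.
  by rewrite !ltr0_sg.
- by move=> h1 h2 h3 h4; case: ifP => _ e; exfalso; lia.
- by move=> h1 h2 h3 h4; case: ifP => _ e; exfalso; lia.
- by move=> _ _ _ _ e g [<-|gi]; [apply: same1 => //|]; exact: c1P.
Qed.

Lemma sign_code_fin (D I : finType) (f : I -> (D -> R) -> R) :
  (forall i, exists a b, forall x, f i x = b + \sum_k a k * x k) ->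
  exists c : (D -> R) -> nat,
    (forall x, (c x < (2 * #|I| + 1) ^ #|D|)%N) /\
    (forall x y, c x = c y -> forall i, Num.sg (f i x) = Num.sg (f i y)).
Proof.
move=> aff; pose g i (z : 'I_#|D| -> R) := f i (fun k => z (enum_rank k)).
have gI i : List.In (g i) [seq g i | i <- enum I].
  have : i \in enum I by rewrite mem_enum.
  by elim: (enum I) => //= j l IHl; rewrite inE => /predU1P[->|/IHl]; [left|right].
have gP h : List.In h [seq g i | i <- enum I] -> exists i, h = g i.
  by elim: (enum I) => //= j l IHl [<-|/IHl//]; exists j.
have [|c [clt cP]] := @sign_code _ [seq g i | i <- enum I].
  move=> h /gP[i ->]; have [a [b fE]] := aff i.
  exists (fun k => a (enum_val k)), b => z; rewrite /g fE; congr (_ + _).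
  rewrite (reindex (fun i : 'I_#|D| => enum_val i)) /=; last by apply: onW_bij; exact: enum_val_bij.
  by apply: eq_bigr => k _; rewrite enum_valK.
exists (fun x => c (fun k => x (enum_val k))); split=> [x|x y e i].
  by have := clt (fun k => x (enum_val k)); rewrite size_map -cardE.
have := cP _ _ e _ (gI i); rewrite /g.
have K (z : D -> R) : (fun k => z (enum_val (enum_rank k))) = z.
  by apply/funext => k; rewrite enum_rankK.
by rewrite !K.
Qed.
End SignCode.

(** * A tiling is determined by its frame and its marks *)

Section Reconstruction.
Context {R : realType}.
Implicit Types (W H : bool -> R) (T : bool -> R -> R -> Prop) (s : seq bool).

(* [c u u'] reads: the coordinate [u] of the first tiling corresponds to the
   coordinate [u'] of the second one. *)
Record coord_match (N A : R) W (c : R -> R -> Prop) : Prop := CoordMatch {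
  match_lt : forall u u' v v', c u u' -> c v v' -> (u < v) = (u' < v');
  match_add : forall u u' b, c u u' -> u < N + A -> c (u + W b) (u' + W b);
  match_gt0 : forall u u', c u u' -> (0 < u) = (0 < u');
  match_ltN : forall u u', c u u' -> (u < N) = (u' < N) }.

(** These are the conditions of [floor_row_exists]; the top edge of the tile may leave the
    window. *)
Definition inner (N : R) W b (p q : R) := [&& 0 < p, p + W b < N, 0 < q & q < N].

Definition in_frame (N A : R) W b (p q : R) :=
  [&& - A < p, p < N + A, - A < q, q < N + A & ~~ inner N W b p q].

Section CoordMatch.
Variables (N A : R) (W : bool -> R) (c : R -> R -> Prop).
Hypothesis M : coord_match N A W c.

Lemma match_fun u u1 u2 : c u u1 -> c u u2 -> u1 = u2.
Proof.
move=> h1 h2; apply/eqP; rewrite eq_le !leNgt.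
by rewrite -(match_lt M h2 h1) -(match_lt M h1 h2) ltxx.
Qed.

Lemma match_inj u1 u2 u : c u1 u -> c u2 u -> u1 = u2.
Proof.
move=> h1 h2; apply/eqP; rewrite eq_le !leNgt.
by rewrite (match_lt M h2 h1) (match_lt M h1 h2) ltxx.
Qed.

Lemma match_sz u u' s : (forall b, 0 < W b) -> c u u' -> u + extent W s < N + A ->
  c (u + extent W s) (u' + extent W s).
Proof.
move=> W0; elim/last_ind: s => [|s b IH]; first by rewrite extent_nil !addr0.
rewrite extent_rcons !addrA => h lt; apply: (match_add M); last first.
  by apply: lt_trans lt; rewrite ltrDl.
by apply: IH => //; apply: lt_trans lt; rewrite ltrDl.
Qed.
End CoordMatch.

Section Match.
Variables (m : R) (W H : bool -> R) (T T' : bool -> R -> R -> Prop) (N A : R).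
Variables (cx cy : R -> R -> Prop).
Hypotheses (G : irr_dissection m W H T) (G' : irr_dissection m W H T').
Hypotheses (AW : forall b, W b <= A) (AH : forall b, H b <= A).
Hypotheses (Mx : coord_match N A W cx) (My : coord_match N A H cy).
Hypothesis frame : forall b p q, T b p q -> in_frame N A W b p q ->
  exists p' q', [/\ cx p p', cy q q' & T' b p' q'].
Hypothesis frame' : forall b p' q', T' b p' q' -> in_frame N A W b p' q' ->
  exists p q, [/\ cx p p', cy q q' & T b p q].
Hypothesis marks : forall kind z v x s k, (kind < 7)%N ->
  marked W H T N kind z v x s k -> exists z' v' x' s' k',
  [/\ marked W H T' N kind z' v' x' s' k', cx x x' /\ cy v v',
   cx (vertex W x s k) (vertex W x' s' k'), nth false s 0 = nth false s' 0
   & nth false s k = nth false s' k'].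
Hypothesis marks' : forall kind z' v' x' s' k', (kind < 7)%N ->
  marked W H T' N kind z' v' x' s' k' -> exists z v x s k,
  [/\ marked W H T N kind z v x s k, cx x x' /\ cy v v',
   cx (vertex W x s k) (vertex W x' s' k'), nth false s 0 = nth false s' 0
   & nth false s k = nth false s' k'].

Definition matched (b : bool) (p q : R) := exists p' q', [/\ cx p p', cy q q' & T' b p' q'].

Lemma marked_some (U : bool -> R -> R -> Prop) v x s : irr_dissection m W H U ->
  floor_row W H U N v x s -> ~ regular W H U v x s ->
  exists kind z k, (kind < 7)%N /\ marked W H U N kind z v x s k.
Proof.
move=> GU f nr; have [/existsP[k ck]|nk] := boolP [exists k : 'I_(size s), change s k].
  by have [kind [z mk]] := marked_complete GU f nr ck; exists kind, z, k.
have sE : s = nseq (size s) (head false s).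
  apply: no_change => k; apply/negP => ck; have /and3P[_ kt _] := ck.
  by move/existsPn/(_ (Ordinal kt)): nk; rewrite ck.
rewrite sE in f nr *; have [kind [z mk]] := marked_nseq GU f nr.
by exists kind, z, 0.
Qed.

(** The tile below the line has [v] as its top, which is how the height [v] is carried over to the
    other dissection. *)
Lemma ground v x b s y : tile_row W T v x (b :: s) -> x <= y -> y < x + extent W (b :: s) ->
  exists d p q, [/\ T d p q, p <= y, y < p + W d & q + H d = v].
Proof.
move=> r xy yx; have wall := tile_row_hwall G r.
have G2 := flipy_irr G.
have [d [p [q [t px xp qv vq]]]] :=
  cover_ne (mesh_gt0 G2) (mesh_leW G2) (mesh_leH G2) (irr_diss G2) y (- v).
exists d, p, (- q - H d); split=> //; apply/eqP; rewrite eq_le; apply/andP; split; last by lra.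
rewrite leNgt; apply/negP => lt; apply: (wall _ _ _ t) => //; lra.
Qed.

Lemma count_lt (X : eqType) (a1 a2 : pred X) (l : seq X) (x : X) :
  (forall z, a1 z -> a2 z) -> x \in l -> a2 x -> ~~ a1 x -> (count a1 l < count a2 l)%N.
Proof.
move=> a12; elim: l => //= z l IHl; rewrite inE => /predU1P[<-|xl] x2 x1.
  by rewrite (negbTE x1) x2 add0n add1n ltnS; exact: sub_count.
by rewrite -addnS leq_add ?IHl//; move: (a12 z); case: (a1 z) => // ->.
Qed.

Lemma lcp_split (s s' : seq bool) : exists t u u', [/\ s = t ++ u, s' = t ++ u' &
  if u is b :: _ then if u' is b' :: _ then b != b' else true else true].
Proof.
elim: s s' => [|b s IHs] [|b' s']; [by exists [::], [::], [::]
  |by exists [::], [::], (b' :: s')|by exists [::], (b :: s), [::]|].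
have [->|bb] := eqVneq b b'; last by exists [::], (b :: s), (b' :: s').
by have [t [u [u' [-> -> tu]]]] := IHs s'; exists (b' :: t), u, u'.
Qed.

Section Step.
Variables (v x : R) (s : seq bool).
Hypothesis f : floor_row W H T N v x s.
Hypothesis IH : forall b p q, T b p q -> - A < p -> p < N + A -> - A < q -> q < v ->
  matched b p q.

Lemma W_gt0 b : 0 < W b. Proof. exact: width_gt0 G b. Qed.

Lemma H_gt0 b : 0 < H b. Proof. exact: height_gt0 G b. Qed.

Lemma matched_left : exists c p' q', [/\ T' c p' q', cx x (p' + W c) &
   exists2 q, cy q q' & q <= v /\ v < q + H c].
Proof.
have [[_ _ [v0 vN] [x0 xN]] [eL _]] := f.
have sg := extent_ge0 G s.
case: eL => [[c [q [tc q1 q2]]]|[c [tc le]]].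
  have Ac := AW c; have Hc := AH c; have Wc := W_gt0 c.
  have [||||p' [q' [h1 h2 h3]]] := IH tc; [lra..|].
  exists c, p', q'; split; [exact: h3| |by exists q; rewrite ?ltW].
  by rewrite -[x](subrK (W c)); apply: (match_add Mx) => //; lra.
have Ac := AW c; have Hc := H_gt0 c; have Wc := W_gt0 c.
have [|p' [q' [h1 h2 h3]]] := frame tc.
  rewrite /in_frame /inner [0 < x - _]ltNge le /= andbT.
  by apply/and4P; split; lra.
exists c, p', q'; split; [exact: h3| |by exists v; rewrite ?ltrDl].
by rewrite -[x](subrK (W c)); apply: (match_add Mx) => //; lra.
Qed.

Lemma matched_ground y y' : cx y y' -> x <= y -> y < x + extent W s ->
  exists d p' q', [/\ T' d p' q', p' <= y', y' < p' + W d & cy v (q' + H d)].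
Proof.
have [[sn r [v0 vN] [x0 xN]] _] := f.
move=> yy xy yx; have [d [p [q [td h1 h2 h3]]]] : exists d p q,
    [/\ T d p q, p <= y, y < p + W d & q + H d = v].
  by case: s sn r xN yx => // b s' _ r _; exact: ground r xy.
have Ad := AW d; have Hd := AH d; have H0 := H_gt0 d.
have [||||p' [q' [k1 k2 k3]]] := IH td; [lra..|].
exists d, p', q'; split=> //.
- by rewrite leNgt -(match_lt Mx yy k1) -leNgt.
- by rewrite -(match_lt Mx yy (match_add Mx _ k1 _)) //; lra.
- by rewrite -h3; apply: (match_add My) => //; lra.
Qed.

(** The tile left of the row supplies [x] and the tile below it supplies [v]. Their counterparts in
    [T'] meet at a corner that a new tile must fill. *)
Lemma matched_start : exists x' v', [/\ cx x x', cy v v',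
  (exists c p' q', [/\ T' c p' q', p' + W c = x', q' <= v' & v' < q' + H c]) &
  exists b, T' b x' v'].
Proof.
have [[sn _ [v0 vN] [x0 xN]] _] := f.
have [c [p' [q' [tc xx [q1 c1 [le1 lt1]]]]]] := matched_left.
have [||d [p2 [q3 [td h1 h2 vv]]]] := matched_ground xx.
- exact: lexx.
- by rewrite ltrDl (extent_gt0 G).
have e1 : q' <= q3 + H d by rewrite leNgt -(match_lt My vv c1) -leNgt.
have e2 : q3 + H d < q' + H c.
  by rewrite -(match_lt My vv (match_add My _ c1 _))//; have := AH c; lra.
exists (p' + W c), (q3 + H d); split=> //; first by exists c, p', q'.
apply: (tile_row_step G' tc) => // b p q tb l1 l2 l3 l4.
have Hd := H_gt0 d; have Wb := W_gt0 b; have Wd := W_gt0 d.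
by have [||||? ? ?] := dissection_inj (irr_diss G') tb td; [lra..|subst; lra].
Qed.

Lemma matched_ceiling t y y' v' : cx y y' -> cy v v' -> - A < y -> y + extent W t < N ->
  hung_row W H T v y t -> hung_row W H T' v' y' t.
Proof.
have [[_ _ [v0 vN] _] _] := f.
move=> + vv; elim: t y y' => [|b t IHt] y y' yy yA; first by rewrite /hung_row.
rewrite !hung_row_cons extent_cons => ytN [tb r].
have Ab := AW b; have Hb := AH b; have H0 := H_gt0 b; have W0 := W_gt0 b.
have st := extent_ge0 G t.
have [||||p' [q' [k1 k2 k3]]] := IH tb; [lra..|].
split; last by apply: IHt r; [apply: (match_add Mx) => //; lra|lra..].
have <- : q' + H b = v'.
  by apply: (match_fun My _ vv); rewrite -[v](subrK (H b)); apply: (match_add My) => //; lra.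
by rewrite addrK -(match_fun Mx k1 yy).
Qed.

Lemma end_match x' : cx x x' -> cx (x + extent W s) (x' + extent W s).
Proof.
have [[_ _ _ [x0 xN]] _] := f; move=> xx.
by apply: (match_sz Mx W_gt0 xx); have := AW true; have := W_gt0 true; lra.
Qed.

(** An irregular row of [T'] has a mark, which translates back to a mark of [T] on the row with the
    same start. *)
Lemma marked_back x' v' s' : cx x x' -> cy v v' -> floor_row W H T' N v' x' s' ->
  ~ regular W H T' v' x' s' -> ~ regular W H T v x s.
Proof.
move=> xx vv f' /(marked_some G' f')[kind [z [k [k7 mk]]]].
have [z2 [v2 [x2 [s2 [k2 [mk2 [xx2 vv2] _ _ _]]]]]] := marks' k7 mk.
have ? := match_inj Mx xx xx2; have ? := match_inj My vv vv2; subst x2 v2.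
case: mk2 => f2 nr2 _ _; have [[sn _ _ _] _] := f; have [[sn2 _ _ _] _] := f2.
by have [||_ ->] := floor_row_unique G f f2; rewrite ?ltrDl ?(extent_gt0 G).
Qed.

(** The hanging row and the straddling tiles start lower, hence are matched, so [T'] has a floor row
    over the same segment. It is regular by [marked_back], and its hanging row is the known word
    [rev s]. *)
Lemma regular_match x' v' : cx x x' -> cy v v' -> (exists b, T' b x' v') ->
  regular W H T v x s -> tile_row W T' v' x' s.
Proof.
have [[sn _ [v0 vN] [x0 xN]] _] := f; have ss := extent_gt0 G sn.
move=> xx vv [b tb] reg; have [[c1 [q1 [t1 h1 h1']]] [c2 [q2 [t2 h2 h2']]] rD] := reg.
have szr : extent W (rev s) = extent W s by apply: perm_big; rewrite perm_rev.
have ee := end_match xx.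
have rD' : hung_row W H T' v' x' (rev s).
  apply: matched_ceiling xx vv _ _ rD; last by rewrite szr.
  by have := AW true; have := W_gt0 true; lra.
have A1 := AW c1; have B1 := AH c1; have W1 := W_gt0 c1; have H1 := H_gt0 c1.
have A2 := AW c2; have B2 := AH c2; have W2 := W_gt0 c2; have H2 := H_gt0 c2.
have sL' : straddleL W H T' v' x'.
  have [||||p' [q' [k1 k2 k3]]] := IH t1; [lra..|].
  have e : p' + W c1 = x'.
    by apply: (match_fun Mx _ xx); rewrite -[x](subrK (W c1)); apply: (match_add Mx) => //; lra.
  exists c1, q'; rewrite -e addrK -(match_lt My k2 vv); split=> //.
  by rewrite -(match_lt My vv (match_add My _ k2 _))//; lra.
have sR' : straddleR H T' v' (x' + extent W s).
  have [||||p' [q' [k1 k2 k3]]] := IH t2; [lra..|].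
  have e := match_fun Mx k1 ee.
  exists c2, q'; rewrite -e -(match_lt My k2 vv); split=> //.
  by rewrite -(match_lt My vv (match_add My _ k2 _))//; lra.
have wall : hwall W H T' v' x' (x' + extent W s).
  have rn : rev s != [::] by rewrite -size_eq0 size_rev size_eq0.
  by rewrite -szr; case: (rev s) rD' rn => // d t rD' _; exact: hung_row_hwall G' rD'.
have [c [q [tc l1 l2]]] := sR'.
have [||t [r e]] := tile_row_block G' tb wall _ tc _ l2.
- by rewrite ltrDl.
- exact: ltW.
have f' : floor_row W H T' N v' x' (b :: t).
  split; first by rewrite e -(match_gt0 My vv) -(match_ltN My vv) -(match_gt0 Mx xx) -(match_ltN Mx ee).
  by rewrite e; split; left.
have [reg'|nr] := EM (regular W H T' v' x' (b :: t)); last first.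
  by case: (marked_back xx vv f' nr).
have [_ _ rD2] := reg'; suff <- : b :: t = s by [].
have szr2 : extent W (rev (b :: t)) = extent W (rev s).
  rewrite szr; move/addrI: e => <-; apply: perm_big; rewrite perm_rev; exact: perm_refl.
apply: (can_inj revK).
have [u [ue|ue]] := tile_row_prefix (flipy_irr G') rD' rD2.
- move: szr2; rewrite ue extent_cat; case: u {ue} => [|d u]; first by rewrite cats0.
  by move=> h; have h3 := @extent_gt0 _ m W H T G (d :: u) isT; exfalso; lra.
- move: szr2; rewrite ue extent_cat; case: u {ue} => [|d u]; first by rewrite cats0.
  by move=> h; have h3 := @extent_gt0 _ m W H T G (d :: u) isT; exfalso; lra.
Qed.

(** A mark yields a row [s'] of [T'] with the same start and first letter; the two words are
    compared after their longest common prefix. *)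
Lemma irregular_match x' v' : cx x x' -> cy v v' -> ~ regular W H T v x s ->
  tile_row W T' v' x' s.
Proof.
move=> xx vv nr; have [kind [z [k [k7 mk]]]] := marked_some G f nr.
have [z1 [v1 [x1 [s' [k1 [mk1 [xx1 vv1] _ s0 _]]]]]] := marks k7 mk.
have ? := match_fun Mx xx xx1; have ? := match_fun My vv vv1; subst x1 v1.
case: mk1 => f' nr' _ _ {xx1 vv1 k7 mk k z1 kind k1 z}.
have [[sn r [v0 vN] [x0 xN]] [_ eR]] := f; have [[sn' r' _ [x0' xN']] [_ eR']] := f'.
have [t [u [u' [sE sE' tu]]]] := lcp_split s s'.
have X_lt : x + extent W t < N.
  by have := extent_ge0 G u; move: xN; rewrite sE extent_cat; lra.
have XX : cx (x + extent W t) (x' + extent W t).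
  by apply: (match_sz Mx W_gt0 xx); have := AW true; have := W_gt0 true; lra.
case: u sE tu => [|b u] sE; case: u' sE' => [|b' u'] sE' tu.
- by rewrite sE -sE'.
(* The tile that ends the first row has a counterpart in [T'] which overlaps the next tile of [s'],
   or equals it and reaches the side of the window. *)
- exfalso; rewrite cats0 in sE; subst t.
  move: (r'); rewrite sE' tile_row_cat => -[_ [tb _]].
  have su := extent_ge0 G u'.
  move: xN'; rewrite sE' extent_cat extent_cons => xN'.
  have Wb' := W_gt0 b'; have Hb' := H_gt0 b'.
  case: eR => [[c [q [tc h1 h2]]]|[c [tc le]]].
    have Ac := AW c; have Bc := AH c; have Wc := W_gt0 c; have Hc := H_gt0 c.
    have ss := extent_ge0 G s.
    have [||||p' [q' [k1 k2 k3]]] := IH tc; [lra..|].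
    have e := match_fun Mx k1 XX.
    have h3 : v' < q' + H c by rewrite -(match_lt My vv (match_add My _ k2 _))//; lra.
    rewrite (match_lt My k2 vv) in h1.
    by have [||||? ? ?] := dissection_inj (irr_diss G') tb k3; [lra..|subst; lra].
  have Ac := AW c; have Wc := W_gt0 c; have ss := extent_ge0 G s.
  have [|p' [q' [k1 k2 k3]]] := frame tc.
    rewrite /in_frame /inner [_ + _ + W c < N]ltNge le /= andbF /= andbT.
    by apply/and4P; split; have := AH c; have := H_gt0 c; lra.
  have ? := match_fun Mx k1 XX; have ? := match_fun My k2 vv; subst p' q'.
  have ? := corner_type (mesh_gt0 G) (mesh_leW G) (mesh_leH G) (irr_diss G') tb k3; subst b'.
  have := match_ltN Mx (match_add Mx c XX _); rewrite [X in _ -> X = _]ltNge le /=.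
  by move=> h; have /esym := h ltac:(lra); lra.
- exfalso; rewrite cats0 in sE'; subst t.
  have tb : T b (x + extent W s') v by move: r; rewrite sE tile_row_cat => -[_ []].
  have su := extent_ge0 G u; have ss' := extent_ge0 G s'; have Wb := W_gt0 b.
  move: xN; rewrite sE extent_cat extent_cons => xN.
  case: eR' => [[c [q [tc h1 h2]]]|[c [tc le]]].
    have [||d [p2 [q2 [td k1 k2 k3]]]] := matched_ground XX.
    - by rewrite lerDl.
    - by rewrite sE extent_cat extent_cons; lra.
    have e := match_fun My k3 vv; have Hc := H_gt0 c; have Hd := H_gt0 d.
    have Wc := W_gt0 c; have Wd := W_gt0 d.
    by have [||||? ? ?] := dissection_inj (irr_diss G') tc td; [lra..|subst; lra].
  have [[_ _ [v0' vN'] _] _] := f'.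
  have Ac := AW c; have Bc := AH c; have Wc := W_gt0 c; have Hc := H_gt0 c.
  have [|p [q [k1 k2 k3]]] := frame' tc.
    rewrite /in_frame /inner [_ + _ + W c < N]ltNge le /= andbF /= andbT.
    by apply/and4P; split; lra.
  have ? := match_inj Mx k1 XX; have ? := match_inj My k2 vv; subst p q.
  have ? := corner_type (mesh_gt0 G) (mesh_leW G) (mesh_leH G) (irr_diss G) tb k3; subst c.
  have lt : x + extent W s' + W b < N by lra.
  move: le; rewrite leNgt -(match_ltN Mx (match_add Mx b XX _)) ?lt//.
  by lra.
exfalso; have nE : nth false s (size t) = b by rewrite sE nth_cat ltnn subnn.
have nE' : nth false s' (size t) = b' by rewrite sE' nth_cat ltnn subnn.
have tk : take (size t) s = t by rewrite sE take_size_cat.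
have tk' : take (size t) s' = t by rewrite sE' take_size_cat.
have lts : (size t < size s)%N by rewrite sE size_cat /= addnS ltnS leq_addr.
have lts' : (size t < size s')%N by rewrite sE' size_cat /= addnS ltnS leq_addr.
(* The prefix is not empty, since marks record the first letter. *)
case: (lastP t) => [|t0 c] in sE sE' nE nE' tk tk' lts lts' XX *.
  by move: s0; rewrite nE nE'; apply/eqP.
have cE : nth false s (size (rcons t0 c)).-1 = c.
  by rewrite sE nth_cat size_rcons ltnSn nth_rcons ltnn eqxx.
have cE' : nth false s' (size (rcons t0 c)).-1 = c.
  by rewrite sE' nth_cat size_rcons ltnSn nth_rcons ltnn eqxx.
(* As [b] and [b'] differ, exactly one word changes type here; its mark imposes the letter after the
   change on the other word. *)
have [cb|cb] := eqVneq c b.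
- have ch : change s' (size (rcons t0 c)).
    by rewrite /change lts' nE' cE' cb tu size_rcons.
  have [kind [z [k7 mk]]] := marked_complete G' f' nr' ch.
  have [z1 [v1 [x1 [s1 [k1 [mk1 [xx1 vv1] XX1 _ ne]]]]]] := marks' k7 mk.
  have ? := match_inj Mx xx xx1; have ? := match_inj My vv vv1; subst x1 v1.
  case: mk1 => f1 _ ks1 _; have [[sn1 _ _ _] _] := f1.
  have [||_ e] := floor_row_unique G f f1; rewrite ?ltrDl ?(extent_gt0 G)//; subst s1.
  move: XX1; rewrite /vertex tk' => /(match_inj Mx XX) /addrI; rewrite -{1}tk.
  move=> /(extent_take_inj G lts ks1) e; move: ne; rewrite -e nE nE' => e2.
  by rewrite e2 eqxx in tu.
- have ch : change s (size (rcons t0 c)) by rewrite /change lts nE cE cb size_rcons.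
  have [kind [z [k7 mk]]] := marked_complete G f nr ch.
  have [z1 [v1 [x1 [s1 [k1 [mk1 [xx1 vv1] XX1 _ ne]]]]]] := marks k7 mk.
  have ? := match_fun Mx xx xx1; have ? := match_fun My vv vv1; subst x1 v1.
  case: mk1 => f1 _ ks1 _; have [[sn1 _ _ _] _] := f1.
  have [||_ e] := floor_row_unique G' f' f1; rewrite ?ltrDl ?(extent_gt0 G)//; subst s1.
  move: XX1; rewrite /vertex tk => /(match_fun Mx XX) /addrI; rewrite -{1}tk'.
  move=> /(extent_take_inj G' lts' ks1) e; move: ne; rewrite -e nE nE' => e2.
  by rewrite e2 eqxx in tu.
Qed.

End Step.

(** The treatment of one row is a hypothesis so that the same induction can also compare a
    dissection with itself, where that hypothesis is immediate. *)
Lemma reconstruction_rows :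
  (forall v x s x' v', floor_row W H T N v x s ->
    (forall b p q, T b p q -> - A < p -> p < N + A -> - A < q -> q < v -> matched b p q) ->
    cx x x' -> cy v v' -> (exists b, T' b x' v') -> tile_row W T' v' x' s) ->
  forall b p q, T b p q -> - A < p -> p < N + A -> - A < q -> q < N + A -> matched b p q.
Proof.
move=> rows b p q.
have [l lP] := local_finite (mesh_gt0 G) (mesh_leW G) (mesh_leH G) (irr_diss G) (`|N| + A).
have lT c p1 q1 : T c p1 q1 -> - A < p1 -> p1 < N + A -> - A < q1 -> q1 < N + A ->
    (c, p1, q1) \in l.
  move=> t h1 h2 h3 h4; have := ler_norm N; have := normr_ge0 N => *.
  by apply: lP t _ _; rewrite ler_norml; apply/andP; split; lra.
(* Heights are real, so the induction counts the finitely many relevant tiles that start below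
   [u]. *)
pose cnt (u : R) := count (fun z : bool * R * R => z.2 < u) l.
have [n] : exists n, (cnt q < n)%N by exists (cnt q).+1.
elim: n b p q => // n IH b p q; rewrite ltnS => le t p1 p2 q1 q2.
have [fr|nfr] := boolP (in_frame N A W b p q); first exact: frame.
move: nfr; rewrite /in_frame p1 p2 q1 q2 /= negbK => /and4P[x0 xN v0 vN].
have [x [s1 [s2 [f xE]]]] := floor_row_exists G t x0 xN v0 vN.
have low c p3 q3 : T c p3 q3 -> - A < p3 -> p3 < N + A -> - A < q3 -> q3 < q -> matched c p3 q3.
  move=> tc h1 h2 h3 h4; apply: IH => //; last by lra.
  apply: leq_trans le; apply: (count_lt (x := (c, p3, q3))) => /=.
  - by move=> z /lt_trans; apply.
  - by apply: lT => //; lra.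
  - by [].
  - by rewrite ltxx.
have [x' [v' [xx vv _ tx]]] := matched_start f low.
have := rows _ _ _ _ _ f low xx vv tx; rewrite tile_row_cat => -[_ [tb _]]; exists (x' + extent W s1), v'; split=> //.
have [_ xszN] : 0 < x /\ x + extent W (s1 ++ b :: s2) < N by case: f => -[].
have s2_ge0 := extent_ge0 G s2; have Wb := W_gt0 b; have := AW b => AWb.
rewrite xE; apply: (match_sz Mx W_gt0 xx).
by move: xszN; rewrite extent_cat extent_cons; lra.
Qed.

Lemma reconstruction b p q : T b p q -> - A < p -> p < N + A -> - A < q -> q < N + A ->
  matched b p q.
Proof.
apply: reconstruction_rows => v x s x' v' f low xx vv tx.
have [reg|nr] := EM (regular W H T v x s).
  exact: (regular_match f low).
exact: (irregular_match f low).
Qed.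
End Match.
End Reconstruction.

(** * The code of a tiling *)

Section Coding.
Context {R : realType}.
Variables (m N A e : R) (W H : bool -> R) (J : nat).
Hypotheses (AW : forall b, W b <= A) (AH : forall b, H b <= A).
Hypotheses (e_gt0 : 0 < e) (NE : N = J%:R * e).

(** A strip of width [A + A] and length [N + A + A] along each side of the window is cut into cells
    of side [m]; each holds at most one corner of each type. *)
Definition near_cells := (Num.truncn ((A + A) / m)).+1.
Definition far_cells := (Num.truncn ((N + A + A) / m)).+1.

(* A cell of the frame of the window: a tile type, the two bits that tell which
   of the four sides is meant, and the position across and along that side. *)
Definition cellT := (bool * (bool * bool) * 'I_near_cells * 'I_far_cells)%type.

Definition in_cell (k : cellT) (p q : R) : Prop :=
  let: (_, (d, t), i, j) := k in
  let near := if d then p else q in let far := if d then q else p in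
  let base := if t then N - A else - A in
  [/\ base <= near < base + A + A, - A <= far < N + A,
      Num.truncn ((near - base) / m) = i & Num.truncn ((far + A) / m) = j].

(* Every coordinate met in the window is a coordinate of some tile of the frame
   plus multiples of the two side lengths; a label records this expression. *)
Definition labelT := (cellT * 'I_far_cells.+1 * 'I_far_cells.+1)%type.

Definition value (V : bool -> R) (X : cellT -> R) (l : labelT) : R :=
  X l.1.1 + l.1.2%:R * V false + l.2%:R * V true.

Section Cells.
Variable T : bool -> R -> R -> Prop.
Hypothesis G : irr_dissection m W H T.
Let m0 := mesh_gt0 G.
Let mW := mesh_leW G.
Let mH := mesh_leH G.

Lemma A_gt0 : 0 < A.
Proof. exact: lt_le_trans (width_gt0 G true) (AW true). Qed.

Lemma N_ge0 : 0 <= N.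
Proof. by rewrite NE mulr_ge0// ltW. Qed.

Lemma in_cell_exists b p q : in_frame N A W b p q -> exists k : cellT, k.1.1.1 = b /\ in_cell k p q.
Proof.
rewrite /in_frame => /and5P[p1 p2 q1 q2].
have Aw := AW b; have A0 := A_gt0; have N0 := N_ge0.
have nlt u : 0 <= u -> u < A + A -> (Num.truncn (u / m) < near_cells)%N.
  by move=> u0 uA; rewrite ltnS; apply: le_truncn; rewrite ler_pM2r ?invr_gt0// ltW.
have flt u : - A < u -> u < N + A -> (Num.truncn ((u + A) / m) < far_cells)%N.
  by move=> u0 uA; rewrite ltnS; apply: le_truncn; rewrite ler_pM2r ?invr_gt0//; lra.
rewrite /inner; case: (ltrP 0 p) => x0 /=.
  case: (ltrP (p + W b) N) => xN /=.
    case: (ltrP 0 q) => v0 /=.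
      rewrite -leNgt => vN.
      have [h1 h2] : 0 <= q - (N - A) /\ q - (N - A) < A + A by split; lra.
      exists (b, (false, true), Ordinal (nlt _ h1 h2), Ordinal (flt _ p1 p2)); split=> //.
      by split=> //; apply/andP; split; lra.
    move=> _; have [h1 h2] : 0 <= q - (- A) /\ q - (- A) < A + A by split; lra.
    exists (b, (false, false), Ordinal (nlt _ h1 h2), Ordinal (flt _ p1 p2)); split=> //.
    by split=> //; apply/andP; split; lra.
  move=> _; have [h1 h2] : 0 <= p - (N - A) /\ p - (N - A) < A + A by split; lra.
  exists (b, (true, true), Ordinal (nlt _ h1 h2), Ordinal (flt _ q1 q2)); split=> //.
  by split=> //; apply/andP; split; lra.
move=> _; have [h1 h2] : 0 <= p - (- A) /\ p - (- A) < A + A by split; lra.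
exists (b, (true, false), Ordinal (nlt _ h1 h2), Ordinal (flt _ q1 q2)); split=> //.
by split=> //; apply/andP; split; lra.
Qed.

Lemma in_cell_uniq (k : cellT) p q p' q' : T k.1.1.1 p q -> T k.1.1.1 p' q' ->
  in_cell k p q -> in_cell k p' q' -> p = p' /\ q = q'.
Proof.
move: k => [[[b [d t]] i] j] /= t1 t2.
set base := if t then _ else _.
move=> [/andP[n1 n2] /andP[f1 f2] ni fj] [/andP[n1' n2'] /andP[f1' f2'] ni' fj'].
have : `|(if d then p else q) - base - ((if d then p' else q') - base)| < m.
  by apply: truncn_close => //; rewrite ?subr_ge0// ni ni'.
have : `|(if d then q else p) + A - ((if d then q' else p') + A)| < m.
  by apply: truncn_close => //; rewrite ?fj ?fj' -?lerBlDr ?sub0r//.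
rewrite !ltr_norml => /andP[h1 h2] /andP[h3 h4].
have := mW b; have := mH b => mh mw.
by case: d {n1 n2 f1 f2 ni fj n1' n2' f1' f2' ni' fj'} h1 h2 h3 h4 => h1 h2 h3 h4;
  have [||||_ -> ->] := dissection_inj (irr_diss G) t1 t2; try lra.
Qed.

(** The default [(0, 0)] of an empty cell still satisfies [cell_pos_ge]; emptiness is told by
    [occupied]. *)
Definition cell_pos (k : cellT) : R * R :=
  xget (0, 0) [set z | T k.1.1.1 z.1 z.2 /\ in_cell k z.1 z.2]%classic.

Definition occupied : {ffun cellT -> bool} :=
  [ffun k : cellT => `[< exists z : R * R, T k.1.1.1 z.1 z.2 /\ in_cell k z.1 z.2 >]].

Definition abscissa k := (cell_pos k).1.
Definition ordinate k := (cell_pos k).2.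

Lemma cell_posE (k : cellT) p q : T k.1.1.1 p q -> in_cell k p q ->
  abscissa k = p /\ ordinate k = q.
Proof.
move=> t c; have [t' c'] := @xgetPex _ (0, 0) [set z | T k.1.1.1 z.1 z.2 /\ in_cell k z.1 z.2]%classic
  (ex_intro _ (p, q) (conj t c)).
by have [? ?] := in_cell_uniq t' t c' c.
Qed.

Lemma cell_pos_ge k : - A <= abscissa k /\ - A <= ordinate k.
Proof.
have A0 := A_gt0; have N0 := N_ge0.
rewrite /abscissa /ordinate /cell_pos.
case: xgetP => [z _ [_ +]|_] /=; last by rewrite oppr_le0 ltW.
by case: k => [[[b [d t]] i] j] /= [/andP[+ _] /andP[+ _] _ _]; case: d; case: t; lra.
Qed.
End Cells.

Section Pair.
Variables T T' : bool -> R -> R -> Prop.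
Hypotheses (G : irr_dissection m W H T) (G' : irr_dissection m W H T').

Definition labelled (V : bool -> R) (X X' : cellT -> R) u u' :=
  exists l, u = value V X l /\ u' = value V X' l.

(** The base coordinate is at least [- A] and each added side at least [m], so a value below [N + A]
    keeps both multiplicities small enough for one more step. *)
Lemma label_add V X l b : (forall b, m <= V b) -> - A <= X l.1.1 -> value V X l < N + A ->
  exists l', forall Z, value V Z l' = value V Z l + V b.
Proof.
case: l => [[k i] j] /= mV Xk; rewrite /value /= => lt.
have m0 := mesh_gt0 G.
have V0 c (n : nat) : n%:R * m <= n%:R * V c by rewrite ler_wpM2l.
have nm (n : nat) : 0 <= n%:R * m :> R by rewrite mulr_ge0// ltW.
have nlt (n : nat) : n%:R * m <= N + A + A -> (n.+1 < far_cells.+1)%N.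
  move=> le; have q0 : 0 <= (N + A + A) / m by rewrite divr_ge0 ?(ltW m0)// (le_trans (nm n)).
  by rewrite !ltnS truncn_ge_nat// ler_pdivlMr.
have := V0 false i; have := V0 true j; have := nm i; have := nm j => *.
have ilt : (i.+1 < far_cells.+1)%N by apply: nlt; lra.
have jlt : (j.+1 < far_cells.+1)%N by apply: nlt; lra.
case: b.
  by exists (k, i, Ordinal jlt) => Z; rewrite /value /= -natr1; ring.
by exists (k, Ordinal ilt, j) => Z; rewrite /value /= -natr1; ring.
Qed.

(** Comparison of labels gives the order of the coordinates. Comparison with [j e] gives the
    precision [e] and, for [j = 0] and [j = J], the position with respect to the window. *)
Definition sign_fun V (i : labelT * labelT + labelT * 'I_J.+1) (X : cellT -> R) : R :=
  match i with
  | inl (l, l') => value V X l - value V X l'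
  | inr (l, j) => value V X l - j%:R * e
  end.

Lemma sum_delta (X : cellT -> R) k0 : \sum_k (k == k0)%:R * X k = X k0.
Proof.
rewrite (bigD1 k0)//= eqxx mul1r big1 ?addr0// => k /negbTE ->.
by rewrite mul0r.
Qed.

Lemma sign_fun_affine V i : exists a b, forall X, sign_fun V i X = b + \sum_k a k * X k.
Proof.
have sD (a a' : cellT -> R) X : \sum_k (a k - a' k) * X k = \sum_k a k * X k - \sum_k a' k * X k.
  by rewrite -sumrB; apply: eq_bigr => k _; rewrite mulrBl.
case: i => [[[[k i] j] [[k' i'] j']]|[[[k i] j] n]].
  exists (fun x => (x == k)%:R - (x == k')%:R), (i%:R * V false + j%:R * V true
    - (i'%:R * V false + j'%:R * V true)) => X.
  by rewrite sD !sum_delta /sign_fun /value /=; ring.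
exists (fun x => (x == k)%:R), (i%:R * V false + j%:R * V true - n%:R * e) => X.
by rewrite sum_delta /sign_fun /value /=; ring.
Qed.

Lemma labelled_match V X X' : (forall b, m <= V b) -> (forall k, - A <= X k) ->
  (forall i, Num.sg (sign_fun V i X) = Num.sg (sign_fun V i X')) ->
  coord_match N A V (labelled V X X').
Proof.
move=> mV XA sg.
have lt0 i : (sign_fun V i X < 0) = (sign_fun V i X' < 0) by rewrite -sgr_lt0 sg sgr_lt0.
have gt0 i : (0 < sign_fun V i X) = (0 < sign_fun V i X') by rewrite -sgr_gt0 sg sgr_gt0.
split.
- move=> u u' v v' [l [-> ->]] [l' [-> ->]].
  by have := lt0 (inl (l, l')); rewrite /= !subr_lt0.
- move=> u u' b [l [-> ->]] lt; have [l' lE] := label_add b mV (XA _) lt.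
  by exists l'; rewrite !lE.
- move=> u u' [l [-> ->]].
  by have := gt0 (inr (l, ord0)); rewrite /= mul0r !subr0.
- move=> u u' [l [-> ->]].
  by have := lt0 (inr (l, ord_max)); rewrite /= -NE !subr_lt0.
Qed.

Lemma labelled_cell V X X' (k : cellT) : labelled V X X' (X k) (X' k).
Proof. by exists (k, ord0, ord0); rewrite /value /= !mul0r !addr0. Qed.

Lemma frame_match b p q : occupied T = occupied T' -> T b p q -> in_frame N A W b p q ->
  exists p' q', [/\ labelled W (abscissa T) (abscissa T') p p',
    labelled H (ordinate T) (ordinate T') q q' & T' b p' q'].
Proof.
move=> /ffunP occ t /(in_cell_exists G)[k [kb kc]]; subst b.
have /asboolP[[p' q'] /= [t' kc']] : `[< exists z : R * R, T' k.1.1.1 z.1 z.2 /\ in_cell k z.1 z.2 >].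
  by have := occ k; rewrite !ffunE => <-; apply/asboolP; exists (p, q).
have [<- <-] := cell_posE G t kc; have [e1 e2] := cell_posE G' t' kc'.
exists (abscissa T' k), (ordinate T' k); split; [exact: labelled_cell..|].
by rewrite e1 e2.
Qed.
End Pair.

Section Table.
Variable T : bool -> R -> R -> Prop.
Hypothesis G : irr_dissection m W H T.

(** The reconstruction is run on [T] against itself: related coordinates are then equal, and to be
    related is to have a label. *)
Lemma labels_exist b p q : T b p q -> - A < p -> p < N + A -> - A < q -> q < N + A ->
  (exists l, p = value W (abscissa T) l) /\ (exists l, q = value H (ordinate T) l).
Proof.
move=> t p1 p2 q1 q2.
have Mx := labelled_match G (mesh_leW G) (fun k => (cell_pos_ge G k).1) (fun i => erefl (Num.sg (sign_fun W i (abscissa T)))).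
have My := labelled_match G (mesh_leH G) (fun k => (cell_pos_ge G k).2) (fun i => erefl (Num.sg (sign_fun H i (ordinate T)))).
have [|p' [q' [[l [e1 _]] [l' [e2 _]] _]]] :=
  reconstruction_rows G G AW AH Mx My (fun b p q => @frame_match T T G G b p q erefl) _ t p1 p2 q1 q2.
  move=> v x s x' v' [[_ r _ _] _] _ [l [xe xe']] [l' [ve ve']] _.
  have -> : x' = x by rewrite xe xe'.
  by have -> : v' = v by rewrite ve ve'.
by split; [exists l|exists l'].
Qed.

Definition entryT := option (bool * bool * labelT * labelT * labelT).

Definition good_entry kind (j : nat) (o : entryT) : Prop :=
  match o with
  | Some (b0, bk, l0, lk, lv) => exists z v x s k,
      [/\ marked W H T N kind z v x s k, Num.truncn (z / m) = j,
          nth false s 0 = b0 /\ nth false s k = bk,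
          x = value W (abscissa T) l0 /\ vertex W x s k = value W (abscissa T) lk
        & v = value H (ordinate T) lv]
  | None => forall z v x s k, marked W H T N kind z v x s k -> Num.truncn (z / m) <> j
  end.

Lemma good_entry_exists kind j : exists o, good_entry kind j o.
Proof.
have [[z [v [x [s [k [mk zj]]]]]]|no] := EM (exists z v x s k,
    marked W H T N kind z v x s k /\ Num.truncn (z / m) = j); last first.
  by exists None => z v x s k mk zj; apply: no; exists z, v, x, s, k.
have [f _ ks _] := mk; have [[sn r [v0 vN] [x0 xN]] _] := f.
have A0 := A_gt0 G.
have lab i : (i < size s)%N -> (exists l, vertex W x s i = value W (abscissa T) l) /\
    exists l, v = value H (ordinate T) l.
  move=> si; have [h1 h2] := vertex_bounds G x si.
  by apply: (labels_exist (tile_row_nth r si)); lra.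
have [[lk lkE] [lv lvE]] := lab k ks.
have [|[l0 l0E] _] := lab 0; first exact: leq_ltn_trans ks.
exists (Some (nth false s 0, nth false s k, l0, lk, lv)), z, v, x, s, k; split=> //.
by rewrite -l0E /vertex take0 extent_nil addr0.
Qed.

Lemma table_exists : exists t : {ffun 'I_7 * 'I_far_cells -> entryT},
  forall i : 'I_7 * 'I_far_cells, good_entry i.1 i.2 (t i).
Proof.
have [t tP] := choice (fun i : 'I_7 * 'I_far_cells => good_entry_exists i.1 i.2).
by exists [ffun i => t i] => i; rewrite ffunE.
Qed.
End Table.

(** By [marked_uniq] a slot has room for one mark, so any mark of [T] is the one recorded in its
    slot; the same entry describes a mark of [T']. *)
Lemma marks_match T T' (t : {ffun 'I_7 * 'I_far_cells -> entryT}) :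
  irr_dissection m W H T ->
  (forall i : 'I_7 * 'I_far_cells, good_entry T i.1 i.2 (t i)) ->
  (forall i : 'I_7 * 'I_far_cells, good_entry T' i.1 i.2 (t i)) ->
  forall kind z v x s k, (kind < 7)%N -> marked W H T N kind z v x s k ->
  exists z' v' x' s' k', [/\ marked W H T' N kind z' v' x' s' k',
   labelled W (abscissa T) (abscissa T') x x' /\ labelled H (ordinate T) (ordinate T') v v',
   labelled W (abscissa T) (abscissa T') (vertex W x s k) (vertex W x' s' k'),
   nth false s 0 = nth false s' 0 & nth false s k = nth false s' k'].
Proof.
move=> G tP tP' kind z v x s k k7 mk.
have [z0 zN] := marked_bounds G mk; have m0 := mesh_gt0 G; have A0 := A_gt0 G.
have zj : (Num.truncn (z / m) < far_cells)%N.
  by rewrite ltnS; apply: le_truncn; rewrite ler_pM2r ?invr_gt0//; lra.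
have := tP (Ordinal k7, Ordinal zj); have := tP' (Ordinal k7, Ordinal zj).
case: (t _) => [[[[[b0 bk] l0] lk] lv]|] /=; last by move=> _ /(_ _ _ _ _ _ mk).
move=> [z' [v' [x' [s' [k' [mk' zj' [e0' ek'] [x0' xk'] ve']]]]]].
move=> [z1 [v1 [x1 [s1 [k1 [mk1 zj1 [e0 ek] [x0 xk] ve]]]]]].
have [z10 _] := marked_bounds G mk1.
have [ev ex ? ?] := marked_uniq G mk1 mk (truncn_close m0 z10 z0 zj1); subst s1 k1.
exists z', v', x', s', k'; split=> //.
- by split; [exists l0; rewrite -ex|exists lv; rewrite -ev].
- by exists lk; rewrite -ex.
- by rewrite e0 e0'.
- by rewrite ek ek'.
Qed.

Definition sign_count :=
  ((2 * #|(labelT * labelT + labelT * 'I_J.+1)%type : finType| + 1) ^ #|cellT : finType|)%N.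

Definition codeT := ({ffun cellT -> bool} * 'I_sign_count * 'I_sign_count *
  {ffun 'I_7 * 'I_far_cells -> entryT})%type.

Lemma coding (Y : Type) (T : Y -> bool -> R -> R -> Prop) :
  (forall y, irr_dissection m W H (T y)) ->
  exists code : Y -> codeT, forall y y', code y = code y' ->
  forall b p q, T y b p q -> inner N W b p q ->
  exists p' q', [/\ T y' b p' q', `|p - p'| <= e & `|q - q'| <= e].
Proof.
move=> G; have [cx [cxlt cxP]] := sign_code_fin (sign_fun_affine W).
have [cy [cylt cyP]] := sign_code_fin (sign_fun_affine H).
have [t tP] := choice (fun y => table_exists (G y)).
exists (fun y => (occupied (T y), Ordinal (cxlt (abscissa (T y))),
  Ordinal (cylt (ordinate (T y))), t y)) => y y' [occ /cxP sx /cyP sy te].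
have tP' := tP y'; rewrite -te in tP'.
have tb := tP y => b p q tile inn.
have sx' i : Num.sg (sign_fun W i (abscissa (T y'))) = Num.sg (sign_fun W i (abscissa (T y))).
  by rewrite sx.
have sy' i : Num.sg (sign_fun H i (ordinate (T y'))) = Num.sg (sign_fun H i (ordinate (T y))).
  by rewrite sy.
have gx k := (cell_pos_ge (G y) k).1; have gy k := (cell_pos_ge (G y) k).2.
have Mx := labelled_match (G y) (mesh_leW (G y)) gx sx.
have My := labelled_match (G y) (mesh_leH (G y)) gy sy.
have sw V (X X' : cellT -> R) u u' : labelled V X X' u u' -> labelled V X' X u' u.
  by move=> [l [h1 h2]]; exists l.
have A0 := A_gt0 (G y).
have /and4P[p0 pN q0 qN] := inn.
have Wb := width_gt0 (G y) b.
(* Equal signs against [j e] and [(j + 1) e] put [u] and [u'] in the same interval of length [e]. *)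
have mesh V X X' u u' : (forall i, Num.sg (sign_fun V i X) = Num.sg (sign_fun V i X')) ->
    0 < u -> u < N -> labelled V X X' u u' -> `|u - u'| <= e.
  move=> sV u0 uN [l [uE uE']]; pose j := Num.truncn (u / e).
  have /andP[j1 j2] : j%:R * e <= u < j.+1%:R * e.
    by rewrite -ler_pdivlMr// -ltr_pdivrMr//; apply: truncn_itv; rewrite divr_ge0// ltW.
  have jJ : (j < J)%N.
    by rewrite -(ltr_nat R) -(ltr_pM2r e_gt0) -NE; exact: le_lt_trans uN.
  have jl : (j < J.+1)%N by rewrite ltnS ltnW.
  have := sV (inr (l, Ordinal jl)); have := sV (inr (l, Ordinal (jJ : j.+1 < J.+1)%N)).
  rewrite /= -uE -uE'; move: j1 j2; rewrite -natr1 mulrDl mul1r => j1 j2 s1 s2.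
  have h1 : u' < j%:R * e + e by rewrite -subr_lt0 -sgr_lt0 -s1 sgr_lt0 subr_lt0.
  have h2 : j%:R * e <= u' by rewrite -subr_ge0 -sgr_ge0 -s2 sgr_ge0 subr_ge0.
  by rewrite ler_norml; apply/andP; split; lra.
have fr' c p' q' : T y' c p' q' -> in_frame N A W c p' q' -> exists p q,
    [/\ labelled W (abscissa (T y)) (abscissa (T y')) p p',
     labelled H (ordinate (T y)) (ordinate (T y')) q q' & T y c p q].
  move=> t' f'; have [p1 [q1 [/sw h1 /sw h2 h3]]] := frame_match (G y') (G y) (esym occ) t' f'.
  by exists p1, q1.
have mk' kind z' v' x' s' k' : (kind < 7)%N -> marked W H (T y') N kind z' v' x' s' k' ->
    exists z v x s k, [/\ marked W H (T y) N kind z v x s k,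
     labelled W (abscissa (T y)) (abscissa (T y')) x x' /\
     labelled H (ordinate (T y)) (ordinate (T y')) v v',
     labelled W (abscissa (T y)) (abscissa (T y')) (vertex W x s k) (vertex W x' s' k'),
     nth false s 0 = nth false s' 0 & nth false s k = nth false s' k'].
  move=> k7 mk; have [z [v [x [s [k [h1 [/sw h2 /sw h3] /sw h4 h5 h6]]]]]] :=
    marks_match (G y') tP' tb k7 mk.
  by exists z, v, x, s, k; split.
have mk := marks_match (G y) tb tP'.
have [||||p' [q' [lx ly t']]] := reconstruction (G y) (G y') AW AH Mx My
  (fun c p q => @frame_match (T y) (T y') (G y) (G y') c p q occ) fr' mk mk' tile; [lra..|].
exists p', q'; split=> //.
- by apply: (mesh W _ _ _ _ _ _ _ lx) => //; lra.
- by apply: (mesh H _ _ _ _ _ _ _ ly).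
Qed.
End Coding.

(** * The logarithm of the number of codes is negligible against the area *)

Section Counting.
Context {R : realType}.
Implicit Types (m N A e : R) (J u n : nat).

Lemma card_entry (X : finType) :
  #|option (bool * bool * X * X * X)%type : finType| = (2 * 2 * #|X| * #|X| * #|X|).+1.
Proof. by rewrite card_option !card_prod card_bool. Qed.

Lemma card_sign (X : finType) n : #|(X * X + X * 'I_n)%type : finType| = (#|X| * #|X| + #|X| * n)%N.
Proof. by rewrite card_sum !card_prod card_ord. Qed.

(** There are 2 types and 4 sides, whence the 8, and 7 kinds of marks. The exponent 22 is 1 + 6 + 6
    + 9, for occupancy, the two sign codes and the table; the factor 5 absorbs
    [2 (u ^ 6 + u ^ 6) + 1] and [4 u ^ 9 + 1]. *)
Lemma card_codeT m N A J u : (8 * near_cells m A * far_cells m N A <= u)%N ->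
  (7 * far_cells m N A <= u)%N -> ((far_cells m N A).+1 <= u)%N -> (J.+1 <= u)%N ->
  (#|codeT m N A J : finType| <= (5 * u) ^ (22 * u))%N.
Proof.
set K := far_cells m N A; set C := near_cells m A => h1 h2 h3 h4.
have u0 : (0 < u)%N by apply: leq_trans h4.
have cC : #|cellT m N A : finType| = (8 * C * K)%N.
  by rewrite !card_prod !card_bool !card_ord -/C -/K; lia.
have cL : (#|labelT m N A : finType| <= u ^ 3)%N.
  rewrite card_prod card_prod !card_ord cC -/K.
  have -> : (u ^ 3 = u * u * u)%N by rewrite !expnS expn0; lia.
  by rewrite !leq_mul.
set L := #|labelT m N A : finType| in cL.
have up k : (0 < u ^ k)%N by rewrite expn_gt0 u0.
have five k : (0 < k)%N -> (5 * u ^ k <= (5 * u) ^ k)%N.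
  by case: k => // k _; rewrite expnMn leq_mul// -{1}[5%N]expn1 leq_exp2l.
have S1 : (sign_count m N A J <= ((5 * u) ^ 6) ^ u)%N.
  rewrite /sign_count cC; apply: (@leq_trans (((5 * u) ^ 6) ^ (8 * C * K))%N); last first.
    by rewrite leq_pexp2l// expn_gt0 muln_gt0 u0.
  have [->|k0] := posnP (8 * C * K); first by rewrite !expn0.
  rewrite leq_exp2r//; apply: leq_trans (five 6 isT).
  have -> : #|(labelT m N A * labelT m N A + labelT m N A * 'I_J.+1)%type : finType| =
      (L * L + L * J.+1)%N.
    exact: card_sign.
  have l1 : (L * L <= u ^ 6)%N by rewrite -[6%N]/(3 + 3)%N expnD leq_mul.
  have l2 : (L * J.+1 <= u ^ 6)%N.
    apply: (@leq_trans (u ^ 3 * u)%N); first by rewrite leq_mul.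
    by rewrite -expnSr leq_pexp2l.
  by have := up 6; lia.
have E1 : (#|entryT m N A : finType| <= (5 * u) ^ 9)%N.
  have -> : #|entryT m N A : finType| = (2 * 2 * L * L * L).+1.
    exact: card_entry.
  apply: leq_trans (five 9 isT).
  have l1 : (L * L * L <= u ^ 9)%N by rewrite -[9%N]/(3 + 3 + 3)%N !expnD !leq_mul.
  by have := up 9; lia.
rewrite card_prod card_prod card_prod !card_ffun card_bool !card_ord cC -/K.
have -> : ((5 * u) ^ (22 * u) =
    (5 * u) ^ u * ((5 * u) ^ 6) ^ u * ((5 * u) ^ 6) ^ u * ((5 * u) ^ 9) ^ u)%N.
  by rewrite -!expnM -!expnD; congr (_ ^ _)%N; lia.
apply: leq_mul; first apply: leq_mul; first apply: leq_mul => //.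
- apply: (@leq_trans (2 ^ u)%N); first by rewrite leq_exp2l.
  by rewrite leq_exp2r//; lia.
- exact: S1.
- rewrite card_prod !card_ord.
  apply: (@leq_trans (((5 * u) ^ 9) ^ (7 * K))%N).
    by rewrite leq_exp2r.
  by rewrite leq_pexp2l// expn_gt0 muln_gt0 u0.
Qed.

(** From [ln x = 2 ln (sqrt x)]. This crude bound turns [n ln n] into the power 3/2 of [n], still
    below [n ^ 2]. *)
Lemma ln_le_sqrt (x : R) : 0 < x -> ln x <= 2 * Num.sqrt x.
Proof.
move=> x0; have s0 : 0 < Num.sqrt x by rewrite sqrtr_gt0.
rewrite -{1}(sqr_sqrtr (ltW x0)) lnXn// -[ln _ *+ 2]mulr_natl ler_pM2l//.
exact: ltW (ln_sublinear s0).
Qed.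

(* The window is a square of side [J e], a multiple of the tolerance [e] that
   exceeds [n + B]. *)
Definition window_steps e B n := (Num.truncn ((n%:R + B) / e)).+1.

Lemma code_growth m A e B (eps : R) : 0 < m -> 0 < e -> 0 <= A -> 0 <= B -> 0 < eps ->
  exists n0, forall n, (n0 <= n)%N -> (0 < n)%N /\
    ln #|codeT m ((window_steps e B n)%:R * e) A (window_steps e B n) : finType|%:R
      <= eps * (n ^ 2)%N%:R.
Proof.
move=> m0 e0 A0 B0 eps0.
pose C := near_cells m A.
(* Chosen so that [kap * (n + 1)] exceeds both [far_cells + 1] and [J + 1]. *)
pose kap : R := (1 + B + e + A + A) / m + (1 + B) / e + 2.
pose D := (8 * C * (Num.truncn kap).+1)%N.
have D0 : (0 < D)%N by rewrite !muln_gt0.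
(* With [u <= 2 D n] the logarithm is at most [22 u * 2 sqrt (10 D n) <= 88 D n sqrt (10 D n)],
   which is below [eps n ^ 2] once [n >= (88 D) ^ 2 * 10 D / eps ^ 2]. *)
exists (Num.truncn ((88 * D%:R) ^+ 2 * (10 * D%:R) / eps ^+ 2)).+1 => n n0n.
have n0 : (0 < n)%N by apply: leq_trans n0n.
split=> //; set J := window_steps e B n; set N := J%:R * e.
pose u := (D * n.+1)%N.
have n1 : 1 <= n%:R :> R by rewrite ler1n.
have J_le : J%:R <= (n%:R + B) / e + 1.
  rewrite /J /window_steps -natr1 lerD2r.
  by have /andP[] := @truncn_itv R ((n%:R + B) / e) (divr_ge0 (addr_ge0 (ler0n _ _) B0) (ltW e0)).
have N_le : N <= n%:R + B + e.
  by move: J_le; rewrite -(ler_pM2r e0) mulrDl mul1r divfK ?gt_eqF.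
have N_ge0 : 0 <= N by rewrite mulr_ge0// ltW.
have K_le : (far_cells m N A)%:R <= (n%:R + B + e + A + A) / m + 1.
  rewrite /far_cells -natr1 lerD2r; have q0 : 0 <= (N + A + A) / m.
    by apply: divr_ge0; [lra|exact: ltW].
  have /andP[le _] := truncn_itv q0; apply: le_trans le _.
  by rewrite ler_pM2r ?invr_gt0//; lra.
have kapE : kap * n.+1%:R <= (Num.truncn kap).+1%:R * n.+1%:R.
  by rewrite ler_wpM2r// ltW// truncnS_gt.
have dm (a : R) : 0 <= a -> 0 <= a / m by move=> a0; apply: divr_ge0 => //; exact: ltW.
have de (a : R) : 0 <= a -> 0 <= a / e by move=> a0; apply: divr_ge0 => //; exact: ltW.
have nB : 0 <= n%:R * B by apply: mulr_ge0.
have ne : 0 <= n%:R * e by rewrite mulr_ge0// ltW.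
have nA : 0 <= n%:R * A by apply: mulr_ge0.
have kap_big : (n%:R + B + e + A + A) / m + 2 <= kap * n.+1%:R /\ (n%:R + B) / e + 2 <= kap * n.+1%:R.
  have t1 : 0 <= (1 + B + e + A + A) / m by apply: dm; lra.
  have t2 : 0 <= (1 + B) / e by apply: de; lra.
  have t3 : (n%:R + B + e + A + A) / m <= (n%:R + 1) * ((1 + B + e + A + A) / m).
    by rewrite mulrA ler_pM2r ?invr_gt0//; lra.
  have t4 : (n%:R + B) / e <= (n%:R + 1) * ((1 + B) / e).
    by rewrite mulrA ler_pM2r ?invr_gt0//; lra.
  rewrite /kap -natr1.
  move: t1 t2 t3 t4; set a := (1 + _ + _ + _ + _) / m; set b := (1 + _) / e.
  set a' := _ / m; set b' := _ / e => t1 t2 t3 t4.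
  have na : 0 <= n%:R * a by apply: mulr_ge0.
  have nb : 0 <= n%:R * b by apply: mulr_ge0.
  by split; lra.
have [kb1 kb2] := kap_big.
have K2 : (far_cells m N A).+1%:R <= (Num.truncn kap).+1%:R * n.+1%:R :> R.
  by rewrite -natr1; lra.
have J2 : J.+1%:R <= (Num.truncn kap).+1%:R * n.+1%:R :> R by rewrite -natr1; lra.
rewrite -natrM ler_nat in K2; rewrite -natrM ler_nat in J2.
have C0 : (0 < C)%N by [].
have card_le : (#|codeT m N A J : finType| <= (5 * u) ^ (22 * u))%N.
  set X := ((Num.truncn kap).+1 * n.+1)%N in K2 J2.
  have uE : u = (8 * C * X)%N by rewrite /u /D -!mulnA.
  have Xu : (X <= u)%N by rewrite uE leq_pmull// muln_gt0.
  apply: card_codeT; rewrite -/C.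
  - by rewrite uE leq_mul2l ltnW ?orbT.
  - rewrite uE; apply: leq_mul; last exact: ltnW.
    by rewrite (@leq_trans 8)// leq_pmulr.
  - exact: leq_trans Xu.
  - exact: leq_trans Xu.
have [->|card0] := posnP #|codeT m N A J : finType|.
  by rewrite ln0// mulr_ge0// ltW.
have u0 : (0 < u)%N by rewrite muln_gt0 D0.
have u5 : 0 < (5 * u)%:R :> R by rewrite ltr0n muln_gt0 u0.
apply: (@le_trans _ _ (ln ((5 * u) ^ (22 * u))%N%:R)).
  by rewrite ler_ln ?posrE ?ltr0n ?expn_gt0 ?muln_gt0 ?u0// ler_nat.
rewrite natrX lnXn// -[ln _ *+ _]mulr_natl.
have u_le : u%:R <= 2 * D%:R * n%:R :> R.
  have n2 : (n.+1 <= 2 * n)%N by rewrite mul2n -addnn -addn1 leq_add2l.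
  by rewrite -!natrM ler_nat /u [(2 * D)%N]mulnC -mulnA leq_mul.
have ln_u : ln ((5 * u)%:R : R) <= 2 * Num.sqrt (10 * D%:R * n%:R : R).
  apply: le_trans (ln_le_sqrt u5) _; rewrite ler_pM2l// ler_wsqrtr//.
  by rewrite natrM; lra.
have DR : 0 < D%:R :> R by rewrite ltr0n.
have nR : 0 < n%:R :> R by rewrite ltr0n.
have sq : Num.sqrt (10 * D%:R * n%:R : R) <= eps * n%:R / (88 * D%:R).
  have c0 : 0 <= eps * n%:R / (88 * D%:R) by rewrite divr_ge0// mulr_ge0// ltW.
  rewrite -[leRHS]ger0_norm// -sqrtr_sqr ler_wsqrtr//.
  rewrite expr_div_n ler_pdivlMr ?exprn_gt0 ?mulr_gt0//.
  have : (88 * D%:R) ^+ 2 * (10 * D%:R) / eps ^+ 2 <= n%:R.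
    by rewrite (le_trans (ltW (truncnS_gt _)))// ler_nat.
  rewrite ler_pdivrMr ?exprn_gt0// => le.
  rewrite -(ler_pM2r nR) in le.
  have -> : 10 * D%:R * n%:R * (88 * D%:R) ^+ 2 = (88 * D%:R) ^+ 2 * (10 * D%:R) * n%:R :> R by ring.
  by have -> : (eps * n%:R) ^+ 2 = n%:R * eps ^+ 2 * n%:R by ring.
rewrite natrM; have s0 : 0 <= Num.sqrt (10 * D%:R * n%:R : R) by exact: sqrtr_ge0.
apply: (@le_trans _ _ (22 * (2 * D%:R * n%:R) * (2 * Num.sqrt (10 * D%:R * n%:R : R)))).
  apply: (@le_trans _ _ (22 * u%:R * (2 * Num.sqrt (10 * D%:R * n%:R : R)))).
    by rewrite ler_wpM2l// mulr_ge0.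
  by rewrite ler_wpM2r ?mulr_ge0// ler_pM2l.
apply: (@le_trans _ _ (88 * D%:R * n%:R * (eps * n%:R / (88 * D%:R)))).
  have := ler_wpM2l (ltW (mulr_gt0 (mulr_gt0 (ltr0n R 88) DR) nR)) sq; lra.
rewrite natrX expr2 le_eqVlt; apply/orP; left; apply/eqP; field.
by rewrite gt_eqF.
Qed.
End Counting.

(** * Compactness of the tiling space *)

Local Open Scope classical_set_scope.
Local Open Scope ring_scope.

Section TilingTopology.
Context {R : realType} {k : nat}.
Variables w h : 'I_k -> R.
Local Notation tiling := (@tiling R k w h).
Local Notation tile := (tile w h).

Lemma tileP i p x : tile i p x <->
  [/\ p.1 <= x.1, x.1 <= p.1 + w i, p.2 <= x.2 & x.2 <= p.2 + h i].
Proof.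
rewrite /Defs.tile /= !in_itv /=.
by split=> [[/andP[-> ->] /andP[-> ->]]|[-> -> -> ->]].
Qed.

Lemma nbhs_box (x : R * R) (A : set (R * R)) : nbhs x A <->
  exists2 e : R, 0 < e & forall z : R * R, `|x.1 - z.1| < e -> `|x.2 - z.2| < e -> A z.
Proof.
split=> [/nbhs_ballP[e /= e0 eA]|[e e0 eA]].
  by exists e => // z z1 z2; apply: eA.
by apply/nbhs_ballP; exists e => //= z [z1 z2]; exact: eA.
Qed.

Lemma interior_tile i p x : interior (tile i p) x <->
  [/\ p.1 < x.1, x.1 < p.1 + w i, p.2 < x.2 & x.2 < p.2 + h i].
Proof.
split=> [/nbhs_box[e e0 eA]|[h1 h2 h3 h4]].
  have e2 : `|e / 2| < e by rewrite gtr0_norm; lra.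
  have n0 : `|0 : R| < e by rewrite normr0.
  have /tileP[/= ? _ ? _] : tile i p (x.1 - e / 2, x.2 - e / 2).
    by apply: eA; rewrite /= opprB addrC subrK.
  have /tileP[/= _ ? _ ?] : tile i p (x.1 + e / 2, x.2 + e / 2).
    by apply: eA; rewrite /= opprD addrA subrr sub0r normrN.
  by split; lra.
pose e := Num.min (Num.min (x.1 - p.1) (p.1 + w i - x.1)) (Num.min (x.2 - p.2) (p.2 + h i - x.2)).
apply/nbhs_box; exists e; first by rewrite /e !lt_min; apply/andP; split; apply/andP; split; lra.
move=> z; rewrite /e !lt_min => /andP[/andP[a1 a2] _] /andP[_ /andP[b1 b2]].
move: a1 a2 b1 b2; rewrite !ltr_norml => /andP[? ?] /andP[? ?] /andP[? ?] /andP[? ?].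
by apply/tileP; split; lra.
Qed.

Hypotheses (w_gt0 : forall i, 0 < w i) (h_gt0 : forall i, 0 < h i).

(** If two rectangles overlap in an open set, the centre of the overlap is interior to both, hence
    not on the frontiers. *)
Lemma is_tilingP (C : 'I_k -> set (R * R)) : is_tiling w h C <->
  (forall x, exists i p, C i p /\ tile i p x) /\
  (forall i j (p q : R * R), C i p -> C j q -> p.1 < q.1 + w j -> q.1 < p.1 + w i ->
    p.2 < q.2 + h j -> q.2 < p.2 + h i -> (i, p) = (j, q)).
Proof.
split=> -[cov dis]; split=> //.
  move=> i j p q Cp Cq h1 h2 h3 h4; apply: contrapT => ne.
  pose mid (a b c d : R) := (Num.max a b + Num.min c d) / 2.
  have midP a b c d : a < d -> b < c -> a < c -> b < d ->
      [/\ a < mid a b c d, b < mid a b c d, mid a b c d < c & mid a b c d < d].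
    by move=> *; rewrite /mid; case: (ltrP a b) => ab; case: (ltrP c d) => cd; split; lra.
  have := w_gt0 i; have := w_gt0 j; have := h_gt0 i; have := h_gt0 j => hj hi wj wi.
  have [||||m1 m2 m3 m4] := midP p.1 q.1 (p.1 + w i) (q.1 + w j); rewrite ?ltrDl//.
  have [||||n1 n2 n3 n4] := midP p.2 q.2 (p.2 + h i) (q.2 + h j); rewrite ?ltrDl//.
  set a := mid _ _ _ _ in m1 m2 m3 m4; set b := mid _ _ _ _ in n1 n2 n3 n4.
  have [|[_ ni] _] := dis i j p q Cp Cq ne (a, b).
    by split; apply/tileP; split=> /=; exact: ltW.
  by apply: ni; apply/interior_tile.
move=> i j p q Cp Cq ne x [tp tq].
have [/= p1 p2 p3 p4] := (tileP i p x).1 tp; have [/= q1 q2 q3 q4] := (tileP j q x).1 tq.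
split; split; [exact: subset_closure| |exact: subset_closure|].
  by move=> /interior_tile[? ? ? ?]; apply: ne; apply: dis => //; lra.
by move=> /interior_tile[? ? ? ?]; apply: ne; apply: dis => //; lra.
Qed.

Lemma open_subbase (A : set tiling) (y : tiling) : open A -> A y ->
  exists E : {fset (set tiling)}, [/\ forall B, B \in E -> @fell_subbase R k w h B,
    forall B, B \in E -> B y & \bigcap_(B in [set` E]) B `<=` A].
Proof.
move=> [D sD <-] [B DB By].
have [E ED EB] := sD _ DB.
exists E; split=> [C /ED /set_mem //|C CE|z Ez].
  by move: By; rewrite /= -EB; apply.
by exists B => //; rewrite /= -EB.
Qed.

(** One-sided on purpose: one direction preserves meeting an open set, the other preserves missing a
    compact set. *)
Definition near_corners (r e : R) (y y' : tiling) := forall i p, y i p ->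
  `|p.1| <= r -> `|p.2| <= r ->
  exists p', [/\ y' i p', `|p.1 - p'.1| <= e & `|p.2 - p'.2| <= e].

Lemma near_corners_refl r e y : 0 <= e -> near_corners r e y y.
Proof. by move=> e0 i p yp _ _; exists p; rewrite !subrr normr0. Qed.

(** * Limits of sequences of tilings along an ultrafilter *)

Section Limit.
Variables (y : nat -> tiling) (F : set_system nat).
Context {FF : UltraFilter F}.
Hypothesis Foo : \oo `<=` F.

Definition limit_corners (i : 'I_k) : set (R * R) := [set p | forall e, 0 < e ->
  F [set n | exists z, [/\ y n i z, `|p.1 - z.1| < e & `|p.2 - z.2| < e]]].

Lemma eventually_small (e : R) : 0 < e -> F [set n | n.+1%:R^-1 < e].
Proof.
move=> e0; apply: Foo; exists (Num.truncn e^-1).+1 => //= n /= en.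
rewrite -[e]invrK ltf_pV2 ?posrE ?invr_gt0//.
by rewrite (lt_le_trans (truncnS_gt _))// ler_nat ltnW.
Qed.

Lemma eventually_large (M : R) : F [set n | M <= n%:R].
Proof.
apply: Foo; exists (Num.truncn M).+1 => //= n /= en.
by rewrite (le_trans (ltW (truncnS_gt _)))// ler_nat.
Qed.

(** Around a point that is not a limit corner, the indices with a corner nearby are not in [F], so
    their complement is; compactness of [K] makes this uniform. *)
Lemma eventually_miss i (K : set (R * R)) : compact K -> limit_corners i `&` K = set0 ->
  F [set n | forall y', near_corners n%:R n.+1%:R^-1 y' (y n) -> y' i `&` K = set0].
Proof.
move=> /compact_near_coveringP cK iK.
pose P n (z : R * R) := forall y', near_corners n%:R n.+1%:R^-1 y' (y n) -> ~ y' i z.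
suff loc : forall x, K x -> \forall x' \near x & n \near F, P n x'.
  have Ff : Filter F by typeclasses eauto.
  have KP := cK nat F P Ff loc; apply: filterS KP => n KP y' yy'.
  by rewrite -subset0 => z [yz /KP nz]; exact: (nz _ yy' yz).
move=> p Kp.
have : ~ limit_corners i p by move=> ip; have : set0 p by rewrite -iK.
move=> /existsNP[e /not_implyP[e0 nF]].
have [//|nhit] := in_ultra_setVsetC [set n | exists z, [/\ y n i z, `|p.1 - z.1| < e & `|p.2 - z.2| < e]] FF.
have e2 : 0 < e / 2 by lra.
pose B := [set n : nat | [/\ n.+1%:R^-1 < e / 2, `|p.1| + e <= n%:R & `|p.2| + e <= n%:R] /\
  ~ exists z, [/\ y n i z, `|p.1 - z.1| < e & `|p.2 - z.2| < e]].
exists ([set z | `|p.1 - z.1| < e / 2 /\ `|p.2 - z.2| < e / 2], B).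
  split=> /=; first by apply/nbhs_box; exists (e / 2).
  have h1 := eventually_small e2.
  have h2 := eventually_large (`|p.1| + e); have h3 := eventually_large (`|p.2| + e).
  by apply: filterS (filterI (filterI h1 (filterI h2 h3)) nhit) => n /= [[? [? ?]] ?].
move=> [z n] /= [[z1 z2] [[n1 n2 n3] nz]] y' yy' yz; apply: nz.
have tri (a b : R) : `|a| <= `|a - b| + `|b| by rewrite -{1}[a](subrK b) ler_normD.
have [||z' [yz' d1 d2]] := yy' _ _ yz.
- by have := tri z.1 p.1; rewrite distrC; lra.
- by have := tri z.2 p.2; rewrite distrC; lra.
exists z'; split=> //.
- by have := ler_distD z.1 p.1 z'.1; have := le_lt_trans d1 n1; lra.
- by have := ler_distD z.2 p.2 z'.2; have := le_lt_trans d2 n1; lra.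
Qed.

Lemma limit_tiling : is_tiling w h limit_corners.
Proof.
apply/is_tilingP; split=> [x|i j p q ip jq h1 h2 h3 h4].
  apply: contrapT => nc.
  (* The possible corners of tiles of type [i] that contain [x]. *)
  pose K i : set (R * R) := `[x.1 - w i, x.1] `*` `[x.2 - h i, x.2].
  have miss i : F [set n | y n i `&` K i = set0].
    have cK : compact (K i) by apply: compact_setX; exact: segment_compact.
    have iK : limit_corners i `&` K i = set0.
      rewrite -subset0 => p [ip]; rewrite /K /= !in_itv /= => -[/andP[? ?] /andP[? ?]].
      by apply: nc; exists i, p; split=> //; apply/tileP; split; lra.
    apply: filterS (eventually_miss cK iK) => n /=; apply.
    by apply: near_corners_refl; rewrite invr_ge0.
  have Ff : Filter F by typeclasses eauto.
  have [n nm] := filter_ex (filter_forall Ff miss).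
  have [i [p [yp /tileP[? ? ? ?]]]] := ((is_tilingP _).1 (cornersP (y n))).1 x.
  have : set0 p by rewrite -(nm i); split=> //; rewrite /K /= !in_itv /=; split; apply/andP; split; lra.
  by [].
(* The least overlap: moving both corners by less than [d] with [d + d <= g] keeps the tiles
   overlapping, so they are one tile of [y n]. *)
pose g := Num.min (Num.min (q.1 + w j - p.1) (p.1 + w i - q.1)) (Num.min (q.2 + h j - p.2) (p.2 + h i - q.2)).
have [g0 [g1 g2] [g3 g4]] : [/\ 0 < g, g <= q.1 + w j - p.1 /\ g <= p.1 + w i - q.1 &
    g <= q.2 + h j - p.2 /\ g <= p.2 + h i - q.2].
  rewrite /g !lt_min !ge_min !lexx !orbT /=; split=> //.
  by apply/andP; split; apply/andP; split; lra.
have key e : 0 < e -> i = j /\ (`|p.1 - q.1| < e /\ `|p.2 - q.2| < e).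
  move=> e0; pose d := Num.min e g / 2.
  have [d0 dg de] : [/\ 0 < d, d + d <= g & d + d <= e].
    have : 0 < Num.min e g by rewrite lt_min e0.
    have : Num.min e g <= e by rewrite ge_min lexx.
    have : Num.min e g <= g by rewrite ge_min lexx orbT.
    by rewrite /d; split; lra.
  have [n [[z [yz z1 z2]] [z' [yz' z1' z2']]]] := filter_ex (filterI (ip d d0) (jq d d0)).
  move: z1 z2 z1' z2'; rewrite !ltr_norml => /andP[? ?] /andP[? ?] /andP[? ?] /andP[? ?].
  have [ij zz] : (i, z) = (j, z').
    by apply: ((is_tilingP _).1 (cornersP (y n))).2 yz yz' _ _ _ _; lra.
  by subst z'; split=> //; split; apply/andP; split; lra.
have [ij _] := key 1 ltr01.
have eq0 (a b : R) : (forall e, 0 < e -> `|a - b| < e) -> a = b.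
  move=> ab; apply/eqP; rewrite -subr_eq0 -normr_eq0; apply/eqP/le_anti.
  rewrite normr_ge0 andbT leNgt; apply/negP => /ab; by rewrite ltxx.
rewrite ij (surjective_pairing p) (surjective_pairing q); congr (_, (_, _)).
- by apply: eq0 => e /key[_ []].
- by apply: eq0 => e /key[_ []].
Qed.

Lemma eventually_open (A : set tiling) : open A -> A (Tiling limit_tiling) ->
  F [set n | forall y', near_corners n%:R n.+1%:R^-1 (y n) y' ->
    near_corners n%:R n.+1%:R^-1 y' (y n) -> A y'].
Proof.
move=> oA Al; have [E [Efell El EA]] := open_subbase oA Al.
pose Q (B : set tiling) := [set n : nat | forall y', near_corners n%:R n.+1%:R^-1 (y n) y' ->
    near_corners n%:R n.+1%:R^-1 y' (y n) -> B y'].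
have QE B : B \in E -> F (Q B).
  move=> BE; have Bl := El B BE.
  have [[i [K [cK BK]]]|[i [G [oG BG]]]] := Efell B BE.
    rewrite BK in Bl *; apply: filterS (eventually_miss cK Bl) => n /= h0 y' _; exact: h0.
  rewrite BG in Bl *; have [p [/= lp Gp]] := Bl.
  have [e e0 eG] := (nbhs_box p G).1 (open_nbhs_nbhs (conj oG Gp)).
  have e2 : 0 < e / 2 by lra.
  apply: filterS (filterI (lp _ e2) (filterI (eventually_small e2)
    (filterI (eventually_large (`|p.1| + e)) (eventually_large (`|p.2| + e))))).
  move=> n /= [[z [yz z1 z2]] [n1 [n2 n3]]] y' yy' _.
  have tri (a b : R) : `|a| <= `|a - b| + `|b| by rewrite -{1}[a](subrK b) ler_normD.
  have [||z' [yz' d1 d2]] := yy' _ _ yz.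
  - by have := tri z.1 p.1; rewrite distrC; lra.
  - by have := tri z.2 p.2; rewrite distrC; lra.
  exists z'; split=> //; apply: eG.
  - by have := ler_distD z.1 p.1 z'.1; have := le_lt_trans d1 n1; lra.
  - by have := ler_distD z.2 p.2 z'.2; have := le_lt_trans d2 n1; lra.
have : F (\bigcap_(B in [set` E]) Q B) by apply: filter_bigI.
apply: filterS => n nQ y' h1 h2; apply: EA => B BE; exact: nQ BE y' h1 h2.
Qed.
End Limit.

(** Otherwise some [y n] fails at radius [n] and tolerance [1 / (n + 1)] for every [n]. A limit
    tiling lies in a member of the cover, which for some [n] contains all tilings that close to
    [y n]. *)
Lemma lebesgue_number (U : set (set tiling)) : open_covering U ->
  exists r e : R, 0 < e /\ forall y, exists2 A, U A &
    forall y', near_corners r e y y' -> near_corners r e y' y -> A y'.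
Proof.
move=> [Uo Uc]; apply: contrapT => no.
have bad (n : nat) : exists y : tiling, forall A, U A -> exists y',
    [/\ near_corners n%:R n.+1%:R^-1 y y', near_corners n%:R n.+1%:R^-1 y' y & ~ A y'].
  apply: contrapT => nb; apply: no; exists n%:R, n.+1%:R^-1; split=> [|y].
    by rewrite invr_gt0.
  apply: contrapT => ny; apply: nb; exists y => A UA; apply: contrapT => nA.
  apply: ny; exists A => // y' h1 h2; apply: contrapT => nAy; apply: nA.
  by exists y'.
have [y yP] := choice bad.
have [F [FU Foo]] := ultraFilterLemma (F := \oo) _.
have : (\bigcup_(A in U) A) (Tiling (limit_tiling y Foo)) by rewrite Uc.
move=> [A UA Al]; have [n nA] := filter_ex (eventually_open (Uo A UA) Al).
have [y' [h1 h2 h3]] := yP n A UA; exact: h3 (nA y' h1 h2).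
Qed.
End TilingTopology.

(** * Entropy *)

Section Entropy.
Context {R : realType}.

(** Equal extents with unequal numbers of [false] would make the ratio a quotient of integers. *)
Lemma irrational_indep (V : bool -> R) : (forall b, 0 < V b) ->
  irrational (V false / V true) -> indep V.
Proof.
move=> V0 irr s t.
have szE u : extent V u = (count_mem true u)%:R * V true + (count_mem false u)%:R * V false.
  elim: u => [|b u IH]; first by rewrite extent_nil !mul0r addr0.
  by rewrite extent_cons IH; case: b => /=; rewrite !natrD; ring.
rewrite !szE; set n1 := count_mem true s; set m1 := count_mem false s.
set n2 := count_mem true t; set m2 := count_mem false t => e.
have mE : m1 = m2.
  apply/eqP; apply: contrapT => /negP ne; apply: irr.
  have ne' : m1%:R - m2%:R != 0 :> R by rewrite subr_eq0 eqr_nat.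
  have Vt : V true != 0 by rewrite gt_eqF.
  exists ((n2%:R - n1%:R) / (m1%:R - m2%:R)) => //.
  rewrite fmorph_div !rmorphB /= !ratr_nat; apply/eqP; rewrite eqr_div//; apply/eqP; lra.
have nE : n1 = n2.
  apply/eqP; rewrite -(eqr_nat R); apply/eqP; apply: (mulIf (x := V true)); first by rewrite gt_eqF.
  by move: e; rewrite mE; lra.
by apply/allP => -[] _ /=; apply/eqP.
Qed.

Variables w h : 'I_2 -> R.
Hypotheses (w_gt0 : forall i, 0 < w i) (h_gt0 : forall i, 0 < h i).
Local Notation tiling := (@tiling R 2 w h).

Definition ix (b : bool) : 'I_2 := if b then ord_max else ord0.

Lemma ix_surj i : exists b, ix b = i.
Proof.
by case: i => -[|[|//]] i2; [exists false|exists true]; apply: val_inj.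
Qed.

Lemma ix_inj : injective ix. Proof. by move=> [] []. Qed.

(** The shift by [s] moves all corners of interest into the window, whose lower left corner is the
    origin. *)
Definition corners_of (s : R) (y : tiling) b p q : Prop := y (ix b) (p - s, q - s).

Lemma tiling_dissection s y : dissection (w \o ix) (h \o ix) (corners_of s y).
Proof.
have [cov dis] := (is_tilingP w_gt0 h_gt0 y).1 (cornersP y).
split=> [a b|b p q b' p' q' t t' h1 h2 h3 h4].
  have [i [p [yp /tileP[/= p1 p2 q1 q2]]]] := cov (a - s, b - s).
  have [c ci] := ix_surj i; subst i; exists c, (p.1 + s), (p.2 + s); split; rewrite /=; try lra.
  by rewrite /corners_of !addrK -surjective_pairing.
have [/ix_inj -> /addIr -> /addIr ->] : (ix b, (p - s, q - s)) = (ix b', (p' - s, q' - s)).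
  by apply: dis; rewrite //=; move: h1 h2 h3 h4; rewrite /=; lra.
by [].
Qed.

Definition min_side := Num.min (Num.min (w ord0) (w ord_max)) (Num.min (h ord0) (h ord_max)).

Lemma tiling_irr s y : irrational (w ord0 / w ord_max) -> irrational (h ord0 / h ord_max) ->
  irr_dissection min_side (w \o ix) (h \o ix) (corners_of s y).
Proof.
move=> wi hi; split; last exact: tiling_dissection.
- by rewrite /min_side !lt_min !w_gt0 !h_gt0.
- by move=> [] /=; rewrite /min_side !ge_min lexx ?orbT.
- by move=> [] /=; rewrite /min_side !ge_min lexx ?orbT.
- by apply: irrational_indep => // b /=.
- by apply: irrational_indep => // b /=.
Qed.

(** A grid of tiles of the first type. Nonemptiness makes every cover number at least 1, hence the
    entropy nonnegative. *)
Lemma tiling_exists : inhabited tiling.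
Proof.
pose C (i : 'I_2) : set (R * R) :=
  [set p | i = ord0 /\ exists a b : int, p = (a%:~R * w ord0, b%:~R * h ord0)].
suff CT : is_tiling w h C by exact: (inhabits (Tiling CT)).
apply/(is_tilingP w_gt0 h_gt0); split=> [x|i j p q [-> [a [b ->]]] [-> [c [d ->]]] /= h1 h2 h3 h4].
  exists ord0, ((Num.floor (x.1 / w ord0))%:~R * w ord0, (Num.floor (x.2 / h ord0))%:~R * h ord0).
  split; first by split=> //; exists (Num.floor (x.1 / w ord0)), (Num.floor (x.2 / h ord0)).
  have fl (z u : R) : 0 < u -> (Num.floor (z / u))%:~R * u <= z /\
      z <= (Num.floor (z / u))%:~R * u + u.
    move=> u0; have /andP[f1 f2] := floor_itv (z / u).
    rewrite -ler_pdivlMr// f1; split=> //; apply: ltW.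
    by rewrite -[X in _ + X]mul1r -mulrDl -ltr_pdivrMr// -[1]/(1%:~R) -intrD.
  have [? ?] := fl x.1 _ (w_gt0 ord0); have [? ?] := fl x.2 _ (h_gt0 ord0).
  by apply/tileP.
have eqi (a' c' : int) (u : R) : 0 < u -> a'%:~R * u < c'%:~R * u + u ->
    c'%:~R * u < a'%:~R * u + u -> a' = c'.
  move=> u0 l1 l2.
  have k1 : (a' < c' + 1)%R by rewrite -(ltr_int R) intrD -(ltr_pM2r u0) mulrDl mul1r.
  have k2 : (c' < a' + 1)%R by rewrite -(ltr_int R) intrD -(ltr_pM2r u0) mulrDl mul1r.
  lia.
by rewrite (eqi _ _ _ (w_gt0 ord0) h1 h2) (eqi _ _ _ (h_gt0 ord0) h3 h4).
Qed.
Definition side_sum := w ord0 + w ord_max + (h ord0 + h ord_max).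

Lemma side_le_sum b : w (ix b) <= side_sum /\ h (ix b) <= side_sum.
Proof.
have := w_gt0 ord0; have := w_gt0 ord_max; have := h_gt0 ord0; have := h_gt0 ord_max.
by rewrite /side_sum; case: b => /= *; split; lra.
Qed.

(** Tilings with equal codes stay close, at the scale of the Lebesgue number, under all translations
    of the square. One choice of members per code thus serves every tiling with that code. *)
Lemma cover_number_le (U : set (set tiling)) :
  irrational (w ord0 / w ord_max) -> irrational (h ord0 / h ord_max) ->
  open_covering U -> exists e B : R, [/\ 0 < e, 0 <= B & forall n,
    (@cover_number R _ (iterated_join (fun v => @translate R 2 w h (v.1%:~R, v.2%:~R)) U n) <=
     #|codeT min_side ((window_steps e B n)%:R * e) side_sum (window_steps e B n) : finType|%:R%:E)%E].
Proof.
move=> wi hi Uc; have [r [e [e0 leb]]] := lebesgue_number w_gt0 h_gt0 Uc.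
have A0 : 0 < side_sum.
  by have := w_gt0 ord0; have := w_gt0 ord_max; have := h_gt0 ord0; have := h_gt0 ord_max; rewrite /side_sum; lra.
(* For corners [p] of a translate by [v] with coordinates at most [|r|] in size, [p + v + s] is
   positive and its tile ends before [n + B < N]. *)
pose s := `|r| + 1; pose B := `|r| + `|r| + 2 + side_sum.
have r0 : 0 <= `|r| by [].
exists e, B; split=> // [|n]; first by rewrite /B; lra.
set J := window_steps e B n; set N := J%:R * e.
have NB : n%:R + B < N by rewrite /N -ltr_pdivrMr// /J /window_steps truncnS_gt.
have aW b : (w \o ix) b <= side_sum by have [] := side_le_sum b.
have aH b : (h \o ix) b <= side_sum by have [] := side_le_sum b.
have [code codeP] := @coding R min_side N side_sum e (w \o ix) (h \o ix) J aW aH e0 erefl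
  tiling (corners_of s) (fun y => tiling_irr s y wi hi).
pose S (v : 'I_n * 'I_n) := @translate R 2 w h ((v.1%:Z)%:~R, (v.2%:Z)%:~R).
have code_near y y' v : code y = code y' -> near_corners r e (S v y) (S v y').
  move=> cc i p yp pr1 pr2; have [b bi] := ix_surj i; subst i.
  have rr : r <= `|r| := ler_norm r.
  move: pr1 pr2; rewrite !ler_norml => /andP[a1 a2] /andP[b1 b2].
  pose v1 : R := (v.1%:Z)%:~R; pose v2 : R := (v.2%:Z)%:~R.
  have v1n : 0 <= v1 /\ v1 <= n%:R by rewrite /v1 /= ler0n ler_nat ltnW.
  have v2n : 0 <= v2 /\ v2 <= n%:R by rewrite /v2 /= ler0n ler_nat ltnW.
  case: v1n v2n => c1 c2 [c3 c4].
  have [q1 [q2 [t d1 d2]]] : exists p' q', [/\ corners_of s y' b p' q',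
      `|p.1 + v1 + s - p'| <= e & `|p.2 + v2 + s - q'| <= e].
    apply: (codeP y y' cc b (p.1 + v1 + s) (p.2 + v2 + s)).
      by rewrite /corners_of !addrK; exact: yp.
    have aWb := aW b; have aHb := aH b.
    by rewrite /inner /=; apply/and4P; split; rewrite /s; move: aWb NB; rewrite /= /B; lra.
  exists (q1 - s - v1, q2 - s - v2); split=> /=.
  - by move: t; rewrite /corners_of /S /translate /=; congr (y' _ _); congr (_, _); rewrite subrK.
  - by move: d1; congr (`|_| <= _); lra.
  - by move: d2; congr (`|_| <= _); lra.
have [y0] := tiling_exists.
have [Asel AP] : exists Asel : tiling -> set tiling, forall y, U (Asel y) /\
    forall y', near_corners r e y y' -> near_corners r e y' y -> Asel y y'.
  suff : forall y, exists A, U A /\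
      forall y', near_corners r e y y' -> near_corners r e y' y -> A y'.
    by move=> hh; have [f fP] := choice hh; exists f.
  by move=> y; have [A UA AA] := leb y; exists A.
pose rep z := xget y0 [set y | code y = z].
have repP y : code (rep (code y)) = code y.
  by have := @xgetPex _ y0 [set y' | code y' = code y] (ex_intro _ y erefl).
pose f z := \bigcap_(v : 'I_n * 'I_n) (S v @^-1` Asel (S v (rep z))).
pose V := [set f z | z in [set code y | y in setT]].
have V_join : V `<=` iterated_join (fun v => @translate R 2 w h (v.1%:~R, v.2%:~R)) U n.
  move=> _ [_ [y _ <-] <-]; exists (fun v => Asel (S v (rep (code y)))) => // v.
  by case: (AP (S v (rep (code y)))).
have V_cover : covering V.
  apply/seteqP; split=> // y _; exists (f (code y)); first by exists (code y) => //; exists y.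
  by move=> v _; apply: (AP _).2; apply: code_near; rewrite repP.
set Z := codeT min_side N side_sum J in code codeP code_near rep repP f V V_join V_cover *.
have V_fin : (V #<= `I_#|Z : finType|)%card.
  pose g i := f (nth (code y0) (enum (Z : finType)) i).
  apply: card_le_trans (card_image_le g _); apply: subset_card_le.
  move=> _ [z _ <-]; exists (index z (enum (Z : finType))).
    by rewrite /= cardE index_mem mem_enum.
  by rewrite /g nth_index// mem_enum.
have [m Vm] : finite_set V by apply/finite_set_leP; exists #|Z : finType|.
apply: (@le_trans _ _ m%:R%:E).
  by apply: ereal_inf_lbound; exists m => //; exists V.
rewrite lee_fin ler_nat -card_le_II.
by rewrite -(card_le_eql Vm).
Qed.

Lemma cover_number_ge1 (X : topologicalType) (U : set (set X)) (x : X) :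
  (1 <= @cover_number R X U)%E.
Proof.
apply: le_ereal_inf_tmp => _ [n [V VU [Vn Vc]] <-].
rewrite lee_fin ler1n lt0n; apply/eqP => n0.
have : (\bigcup_(A in V) A) x by rewrite Vc.
by move=> [A VA _]; move: Vn VA; rewrite n0 II0 card_eq0 => /eqP ->.
Qed.
End Entropy.

Theorem theorem1p2 (R : realType) (w h : 'I_2 -> R)
  (w_gt0 : forall i, 0 < w i) (h_gt0 : forall i, 0 < h i)
  (w_irr : irrational (w ord0 / w ord_max))
  (h_irr : irrational (h ord0 / h ord_max)) :
  entropyR2 (@translate R 2 w h) = 0%E.
Proof.
have [y0] := tiling_exists w_gt0 h_gt0.
pose S := fun v : int * int => @translate R 2 w h (v.1%:~R, v.2%:~R).
have term_ge0 U n : (0 <= ((n ^ 2)%N%:R)^-1%:E * lne (@cover_number R _ (iterated_join S U n)))%E.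
  apply: mule_ge0; first by rewrite lee_fin invr_ge0.
  by rewrite lne_ge0; exact: cover_number_ge1.
have entropy_ge0 U : (0 <= @cover_entropy R _ S U)%E.
  apply: le_ereal_inf_tmp => _ [E oE <-].
  have [n En] := filter_ex oE.
  by apply: le_trans (term_ge0 U n) _; apply: ereal_sup_ubound; exists n.
apply/eqP; rewrite eq_le; apply/andP; split; last first.
  (* The trivial cover already gives the lower bound. *)
  apply: le_trans (entropy_ge0 [set setT]) _; apply: ereal_sup_ubound.
  exists [set setT] => //; split; first by move=> _ ->; exact: openT.
  by rewrite /covering bigcup_set1.
apply: ge_ereal_sup => _ [U Uc <-].
have [e [B [e0 B0 cover_le]]] := cover_number_le w_gt0 h_gt0 w_irr h_irr Uc.
have min_side0 : 0 < min_side w h by rewrite /min_side !lt_min !w_gt0 !h_gt0.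
have sum0 : 0 <= side_sum w h by rewrite /side_sum !addr_ge0// ltW.
apply/lee_addgt0Pr => eps eps0; rewrite add0e.
have [n0 growth] := code_growth min_side0 e0 sum0 B0 eps0.
(* The upper limit is bounded by the supremum over the tail from [n0] on. *)
apply: (@le_trans _ _ (ereal_sup [set ((n ^ 2)%N%:R^-1%:E *
    lne (@cover_number R _ (iterated_join S U n)))%E | n in [set n | (n0 <= n)%N]])).
  apply: ereal_inf_lbound; exists [set n | (n0 <= n)%N] => //.
  exact: nbhs_infty_ge.
apply: ge_ereal_sup => _ [n /= n0n <-].
have [n_gt0 le_eps] := growth n n0n.
have N0 : 0 < (n ^ 2)%N%:R :> R by rewrite ltr0n expn_gt0 n_gt0.
have c1 : (1 <= @cover_number R _ (iterated_join S U n))%E by exact: cover_number_ge1.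
have := cover_le n; set Z := #|_|; move=> cZ.
have Z1 : 1 <= Z%:R :> R by rewrite -lee_fin; exact: le_trans c1 cZ.
apply: (@le_trans _ _ (((n ^ 2)%N%:R)^-1%:E * (ln Z%:R)%:E)%E).
  apply: lee_wpmul2l; first by rewrite lee_fin invr_ge0.
  rewrite -lne_EFin ?(lt_le_trans ltr01)// lee_lne//.
  - by rewrite in_itv /= leey andbT (le_trans _ c1)// lee_fin.
  - by rewrite in_itv /= leey andbT lee_fin (le_trans _ Z1).
by rewrite -EFinM lee_fin mulrC ler_pdivrMr.
Qed.
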